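(* Every sparse paving matroid $\mathsf{M}$ is $\gamma$-positive, i.e. all coefficients of $\gamma_{\mathsf{M}}(t)$ are non-negative.
   Context: A matroid $\mathsf{M}$ of rank $k$ is paving if all its circuits have cardinality at least $k$; it is sparse paving if both $\mathsf{M}$ and its dual $\mathsf{M}^*$ are paving. For a matroid $\mathsf{M}$ with lattice of flats $\mathscr{L}(\mathsf{M})$ and flat $F$, $\mathsf{M}^F$ is the localization (matroid on $F$ whose flats are the flats of $\mathsf{M}$ contained in $F$) and $\mathsf{M}_F$ the contraction (matroid on $E\smallsetminus F$ whose flats are $F'\smallsetminus F$ for flats $F'\supseteq F$); $\chi_{\mathsf{M}}$ is the characteristic polynomial. The Kazhdan–Lusztig polynomial $P_{\mathsf{M}}(t)$ is the unique assignment such that: if $\operatorname{rk}(\mathsf{M})=0$ then $P_{\mathsf{M}}=1$ if the ground set is empty and $0$ otherwise; if $\operatorname{rk}(\mathsf{M})>0$ then $\deg P_{\mathsf{M}}<\operatorname{rk}(\mathsf{M})/2$; and $t^{\operatorname{rk}(\mathsf{M})}P_{\mathsf{M}}(t^{-1})=\sum_{F}\chi_{\mathsf{M}^F}(t)P_{\mathsf{M}_F}(t)$. The $Z$-polynomial is $Z_{\mathsf{M}}(t)=\sum_{F\in\mathscr{L}(\mathsf{M})}t^{\operatorname{rk}(F)}P_{\mathsf{M}_F}(t)$; it satisfies $Z_{\mathsf{M}}(t)=t^{\operatorname{rk}(\mathsf{M})}Z_{\mathsf{M}}(t^{-1})$. The $\gamma$-polynomial $\gamma_{\mathsf{M}}(t)=\sum_{i}\gamma_i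 t^i$ is the unique polynomial with integer coefficients such that $Z_{\mathsf{M}}(t)=\sum_{i=0}^{\lfloor \operatorname{rk}(\mathsf{M})/2\rfloor}\gamma_i t^i(1+t)^{\operatorname{rk}(\mathsf{M})-2i}$. *)

(* Defs.v *)
From HB Require Import structures.
From mathcomp Require Import all_boot all_order all_algebra.
From mathcomp Require Import zify ring.

Set Implicit Arguments.
Unset Strict Implicit.
Unset Printing Implicit Defensive.

Import GRing.Theory Num.Theory.
Local Open Scope ring_scope.

(* A matroid on a subset E of the finite type T, given by its rank function.
   The rank function is extended from subsets of E to subsets of T by
   r A = r (A :&: E), which is what the bound #|A :&: E| amounts to
   (see rkI below); it makes matroids with equal data equal. *)
Definition matroid_axiom (T : finType) (E : {set T})
    (r : {ffun {set T} -> nat}) : bool :=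
  [&& [forall A : {set T}, r A <= #|A :&: E|]%N,
      [forall A : {set T}, forall B : {set T}, (A \subset B) ==> (r A <= r B)%N]
    & [forall A : {set T}, forall B : {set T},
         (r (A :|: B) + r (A :&: B) <= r A + r B)%N]].

Record matroid (T : finType) := Matroid {
  ground : {set T};
  rank_fun : {ffun {set T} -> nat};
  matroidP : matroid_axiom ground rank_fun
}.

Definition rk (T : finType) (M : matroid T) (A : {set T}) : nat := rank_fun M A.

Definition rank (T : finType) (M : matroid T) : nat := rk M (ground M).

Section MatroidTheory.

Variable T : finType.
Implicit Types (M N : matroid T) (A B F G S : {set T}).

Lemma rk_le M A : (rk M A <= #|A :&: ground M|)%N.
Proof. by have /and3P[/forallP h _ _] := matroidP M; apply: h. Qed.

Lemma rk_mono M A B : A \subset B -> (rk M A <= rk M B)%N.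
Proof. by have /and3P[_ /'forall_forallP h _] := matroidP M; apply/implyP/h. Qed.

Lemma rk_submod M A B :
  (rk M (A :|: B) + rk M (A :&: B) <= rk M A + rk M B)%N.
Proof. by have /and3P[_ _ /'forall_forallP h] := matroidP M; apply: h. Qed.

Lemma rkU M A B : (rk M (A :|: B) <= rk M A + rk M B)%N.
Proof. by apply: leq_trans (rk_submod M A B); rewrite leq_addr. Qed.

Lemma rkI M A : rk M A = rk M (A :&: ground M).
Proof.
apply/eqP; rewrite eqn_leq (rk_mono _ (subsetIl _ _)) andbT.
rewrite -{1}(setID A (ground M)); apply: leq_trans (rkU _ _ _) _.
rewrite -[leqRHS]addn0 leq_add2l; apply: leq_trans (rk_le _ _) _.
by rewrite setIDAC setDIl setDv setI0 cards0.
Qed.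

Lemma rk0 M : rk M set0 = 0%N.
Proof. by apply/eqP; rewrite -leqn0; apply: leq_trans (rk_le _ _) _; rewrite set0I cards0. Qed.

Lemma matroid_eq M N : ground M = ground N -> rk M =1 rk N -> M = N.
Proof.
case: M N => [E r p] [E' r' p']; rewrite /rk /= => EE' /ffunP rr'.
by subst; rewrite (bool_irrelevance p p').
Qed.

Lemma matroid_axiomP (E : {set T}) (r : {set T} -> nat) :
  (forall A, (r A <= #|A :&: E|)%N) ->
  (forall A B, A \subset B -> (r A <= r B)%N) ->
  (forall A B, (r (A :|: B) + r (A :&: B) <= r A + r B)%N) ->
  matroid_axiom E (finfun r).
Proof.
move=> h1 h2 h3; apply/and3P; split.
- by apply/forallP => A; rewrite ffunE.
- by apply/'forall_forallP => A B; rewrite !ffunE; apply/implyP/h2.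
- by apply/'forall_forallP => A B; rewrite !ffunE.
Qed.

(* Localization at F: the restriction of M to F. *)
Definition localization_rk M F A : nat := rk M (A :&: F).

Lemma localization_subproof M F :
  matroid_axiom (ground M :&: F) (finfun (localization_rk M F)).
Proof.
apply: matroid_axiomP => [A|A B sAB|A B]; rewrite /localization_rk.
- by apply: leq_trans (rk_le _ _) _; rewrite -setIA [F :&: _]setIC.
- by apply: rk_mono; apply: setSI.
- by have := rk_submod M (A :&: F) (B :&: F); rewrite -setIUl -setIIl.
Qed.

Definition localization M F : matroid T := Matroid (localization_subproof M F).

(* Contraction of F: rank A |-> rk (A :|: F) - rk F on E :\: F. *)
Definition contraction_rk M F A : nat := (rk M (A :|: F) - rk M F)%N.

Lemma contraction_subproof M F :
  matroid_axiom (ground M :\: F) (finfun (contraction_rk M F)).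
Proof.
apply: matroid_axiomP => [A|A B sAB|A B]; rewrite /contraction_rk.
- rewrite leq_subLR.
  have -> : A :|: F = F :|: (A :\: F).
    by apply/setP => x; rewrite !inE; case: (x \in F); rewrite ?orbT ?orbF.
  apply: leq_trans (rkU _ _ _) _; rewrite leq_add2l.
  apply: leq_trans (rk_le _ _) _.
  by rewrite setIDA setIDAC.
- by rewrite leq_sub2r // rk_mono // setSU.
- have := rk_submod M (A :|: F) (B :|: F).
  rewrite -setUUl -setUIl.
  have := rk_mono M (subsetUr A F); have := rk_mono M (subsetUr B F).
  have := rk_mono M (subsetUr (A :&: B) F).
  have := rk_mono M (subsetUr (A :|: B) F).
  lia.
Qed.

Definition contraction M F : matroid T := Matroid (contraction_subproof M F).

Definition dual_rk M A : nat :=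
  (#|A :&: ground M| + rk M (ground M :\: A) - rank M)%N.

Lemma dual_rk_ge M A : (rank M <= #|A :&: ground M| + rk M (ground M :\: A))%N.
Proof.
rewrite /rank -{1}(setID (ground M) A); apply: leq_trans (rkU _ _ _) _.
rewrite leq_add2r; apply: leq_trans (rk_le _ _) _.
by rewrite setIAC setIid setIC.
Qed.

Lemma dual_subproof M : matroid_axiom (ground M) (finfun (dual_rk M)).
Proof.
apply: matroid_axiomP => [A|A B sAB|A B]; rewrite /dual_rk.
- by rewrite leq_subLR addnC leq_add2r rk_mono // subsetDl.
- apply: leq_sub2r.
  have -> : ground M :\: A = (ground M :\: B) :|: ((B :\: A) :&: ground M).
    apply/setP => x; rewrite !inE; have := subsetP sAB x.
    by case: (x \in A); case: (x \in B); case: (x \in ground M) => // ->.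
  have := rkU M (ground M :\: B) ((B :\: A) :&: ground M).
  have := rk_le M ((B :\: A) :&: ground M); rewrite -setIA setIid.
  have := cardsID A (B :&: ground M).
  rewrite setIAC (setIidPr sAB) setIDAC; lia.
- have := rk_submod M (ground M :\: A) (ground M :\: B).
  rewrite -setDIr -setDUr.
  have := cardsUI (A :&: ground M) (B :&: ground M).
  rewrite -setIUl -setIIl.
  have := dual_rk_ge M A; have := dual_rk_ge M B.
  have := dual_rk_ge M (A :|: B); have := dual_rk_ge M (A :&: B).
  lia.
Qed.

Definition dual M : matroid T := Matroid (dual_subproof M).

Definition indep M A : bool := (A \subset ground M) && (rk M A == #|A|).

Definition basis M B : bool := indep M B && (#|B| == rank M).

Definition circuit M C : bool :=
  minset (fun A => (A \subset ground M) && ~~ indep M A) C.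

Definition paving M : Prop := forall C, circuit M C -> (rank M <= #|C|)%N.

Definition sparse_paving M : Prop := paving M /\ paving (dual M).

Definition flat M F : bool :=
  (F \subset ground M) &&
  [forall x in ground M :\: F, rk M F < rk M (x |: F)]%N.

Definition flats M : {set {set T}} := [set F | flat M F].

(* The Boolean expansion of the characteristic polynomial; it vanishes when M
   has a loop, in accordance with the value of P on matroids of rank 0. *)
Definition char_poly_matroid M : {poly int} :=
  \sum_(A in powerset (ground M)) (-1) ^+ #|A| *: 'X^(rank M - rk M A).

(* t^d p(t^-1), for p of degree at most d. *)
Definition rev_poly (d : nat) (p : {poly int}) : {poly int} :=
  \poly_(i < d.+1) p`_(d - i).

(* Every minor of a matroid on a subset of T is again one, so P need only be
   considered on matroids with ground set in T. *)
Definition KL_assignment (P : matroid T -> {poly int}) : Prop :=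
  forall M,
  [/\ rank M = 0%N -> P M = if ground M == set0 then 1 else 0,
      (0 < rank M)%N -> (2 * (size (P M)).-1 < rank M)%N
    & rev_poly (rank M) (P M) =
      \sum_(F in flats M) char_poly_matroid (localization M F) *
                          P (contraction M F)].

Definition Z_poly (P : matroid T -> {poly int}) M : {poly int} :=
  \sum_(F in flats M) 'X^(rk M F) * P (contraction M F).

Definition is_gamma_poly (d : nat) (Z g : {poly int}) : Prop :=
  (size g <= d./2.+1)%N /\
  Z = \sum_(i < d./2.+1) g`_i *: ('X^i * (1 + 'X) ^+ (d - 2 * i)).

End MatroidTheory.

(* The rest of the file checks the definitions: the bases of the dual and the
   flats of the minors are the expected ones (basis_dual, flat_localization,
   flat_contraction), and the objects specified by KL_assignment and
   is_gamma_poly exist and are unique (KL_exists, KL_unique, Z_palindromic,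
   gamma_exists, gamma_unique). *)
Section WellDefinedness.

Variable T : finType.
Implicit Types (M N : matroid T) (A B C F G S : {set T}) (p q g h Z : {poly int}).

Lemma rk_loc M F A : rk (localization M F) A = rk M (A :&: F).
Proof. by rewrite /rk /= ffunE. Qed.

Lemma rk_con M F A : rk (contraction M F) A = (rk M (A :|: F) - rk M F)%N.
Proof. by rewrite /rk /= ffunE. Qed.

Lemma rk_dual M A :
  rk (dual M) A = (#|A :&: ground M| + rk M (ground M :\: A) - rank M)%N.
Proof. by rewrite /rk /= ffunE. Qed.

Lemma basis_dual M B :
  B \subset ground M -> basis (dual M) B = basis M (ground M :\: B).
Proof.
move=> sB; rewrite /basis /indep /rank !rk_dual /= sB subsetDl /=.
rewrite (setIidPl sB) setIid setDv rk0.
have := dual_rk_ge M B; rewrite (setIidPl sB).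
have := rk_mono M (subsetDl (ground M) B).
have := rk_le M (ground M :\: B); rewrite (setIidPl (subsetDl _ _)).
have := rk_le M (ground M); rewrite setIid.
have := cardsID B (ground M); rewrite (setIidPr sB).
rewrite /rank => *; lia.
Qed.

Lemma flatP M F : reflect (F \subset ground M /\
    forall x, x \in ground M -> x \notin F -> (rk M F < rk M (x |: F))%N)
  (flat M F).
Proof.
apply: (iffP andP) => -[sF h]; split=> //.
  by move=> x xE xF; apply: (forall_inP h); rewrite inE xF.
by apply/forall_inP => x; rewrite inE => /andP[xF xE]; apply: h.
Qed.

Lemma rk_eqU M A B x : A \subset B -> rk M (x |: A) = rk M A ->
  rk M (x |: B) = rk M B.
Proof.
move=> sAB e; apply/eqP; rewrite eqn_leq (rk_mono _ (subsetUr _ _)) andbT.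
have := rk_submod M (x |: A) B.
have -> : (x |: A) :|: B = x |: B by rewrite -setUA (setUidPr sAB).
have : (rk M A <= rk M ((x |: A) :&: B))%N.
  by rewrite rk_mono // subsetI subsetUr.
lia.
Qed.

Lemma nonflatP M A : A \subset ground M -> ~~ flat M A ->
  exists2 x, x \in ground M :\: A & rk M (x |: A) = rk M A.
Proof.
move=> sA; rewrite /flat sA /= => /forall_inPn[x xE].
rewrite -leqNgt => h; exists x => //; apply/eqP; rewrite eqn_leq h.
by rewrite rk_mono ?subsetUr.
Qed.

Lemma flat_localization M F G : flat M F ->
  flat (localization M F) G = flat M G && (G \subset F).
Proof.
move=> /flatP[sF hF].
apply/flatP/andP => /= [[sG hG]|[/flatP[sG hG] sGF]].
  move: sG; rewrite subsetI => /andP[sG sGF]; split=> //; apply/flatP.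
  split=> // x xE xG; have [xF|xF] := boolP (x \in F).
    have := hG x; rewrite inE xE xF !rk_loc => /(_ isT xG).
    by rewrite !(setIidPl _) // subUset sub1set xF.
  rewrite ltn_neqAle rk_mono ?subsetUr // andbT; apply/negP => /eqP e.
  by have := hF x xE xF; rewrite (rk_eqU sGF) ?ltnn.
split; first by rewrite subsetI sG.
move=> x; rewrite inE => /andP[xE xF] xG.
by rewrite !rk_loc !(setIidPl _) ?hG // subUset sub1set xF.
Qed.

Lemma flat_contraction M F G : F \subset ground M ->
  flat (contraction M F) G = [disjoint G & F] && flat M (G :|: F).
Proof.
move=> sF; apply/flatP/andP => /= [[sG hG]|[dGF /flatP[sG hG]]].
  move: sG; rewrite subsetD => /andP[sG dGF]; split=> //; apply/flatP.
  split=> [|x xE]; first by rewrite subUset sG.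
  rewrite inE negb_or => /andP[xG xF].
  have := hG x; rewrite inE xE xF !rk_con => /(_ isT xG).
  by rewrite setUA; lia.
move: sG; rewrite subUset => /andP[sG _]; split; first by rewrite subsetD sG.
move=> x; rewrite inE => /andP[xF xE] xG.
have := hG x xE; rewrite inE negb_or xG xF => /(_ isT).
rewrite !rk_con setUA; have := rk_mono M (subsetUr G F); lia.
Qed.

Lemma coef_rev d p i : (rev_poly d p)`_i = if (i <= d)%N then p`_(d - i) else 0.
Proof. by rewrite coef_poly ltnS. Qed.

Lemma rev_polyD d p q : rev_poly d (p + q) = rev_poly d p + rev_poly d q.
Proof. by apply/polyP => i; rewrite coefD !coef_rev coefD; case: ifP; rewrite ?addr0. Qed.

Lemma rev_polyZ d a p : rev_poly d (a *: p) = a *: rev_poly d p.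
Proof. by apply/polyP => i; rewrite coefZ !coef_rev coefZ; case: ifP; rewrite ?mulr0. Qed.

Lemma rev_poly0 d : rev_poly d 0 = 0.
Proof. by apply/polyP => i; rewrite coef_rev !coef0; case: ifP. Qed.

Lemma rev_poly_sum d (I : finType) (Q : pred I) (f : I -> {poly int}) :
  rev_poly d (\sum_(i | Q i) f i) = \sum_(i | Q i) rev_poly d (f i).
Proof. by apply: (big_morph _ (rev_polyD d) (rev_poly0 d)). Qed.

Lemma rev_polyXn d k : (k <= d)%N -> rev_poly d 'X^k = 'X^(d - k).
Proof.
move=> kd; apply/polyP => i; rewrite coef_rev !coefXn; case: leqP => [id|di].
  by congr (_ %:R); congr nat_of_bool; lia.
by case: eqP => // e; lia.
Qed.

Lemma poly_sumE d (p : {poly int}) : (size p <= d.+1)%N ->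
  p = \sum_(i < d.+1) p`_i *: 'X^i.
Proof.
by move=> sp; rewrite -poly_def; apply/polyP => i; rewrite coef_poly;
   case: ltnP => // h; rewrite nth_default // (leq_trans sp).
Qed.

Lemma rev_polyM a b (p q : {poly int}) : (size p <= a.+1)%N -> (size q <= b.+1)%N ->
  rev_poly (a + b) (p * q) = rev_poly a p * rev_poly b q.
Proof.
move=> /poly_sumE-> /poly_sumE->.
rewrite !big_distrlr /= !rev_poly_sum /= big_distrlr /=.
apply: eq_bigr => i _; rewrite rev_poly_sum; apply: eq_bigr => j _.
rewrite -!scalerAl -!scalerAr !rev_polyZ -exprD.
have ? := ltn_ord i; have ? := ltn_ord j.
rewrite !rev_polyXn; [|lia..].
rewrite -scalerAl -scalerAr -exprD; do 2 congr (_ *: _); congr ('X^ _); lia.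
Qed.

Lemma size_rev d p : (size (rev_poly d p) <= d.+1)%N.
Proof. exact: size_poly. Qed.

Lemma rev_polyK d p : (size p <= d.+1)%N -> rev_poly d (rev_poly d p) = p.
Proof.
move=> sp; apply/polyP => i; rewrite !coef_rev leq_subr; case: leqP => h.
  by rewrite subKn.
by rewrite nth_default // (leq_trans sp).
Qed.

Lemma alt_toggle (R : pzRingType) (Q : pred {set T}) (f : {set T} -> R) x :
  (forall A, x \notin A -> Q (x |: A) = Q A) ->
  (forall A, x \notin A -> Q A -> f (x |: A) = - f A) ->
  \sum_(A | Q A) f A = 0.
Proof.
move=> hQ hf; rewrite (bigID (fun A => x \in A)) /=.
rewrite [X in X + _](reindex_onto (fun A => x |: A) (fun A => A :\ x)) /=; last first.
  by move=> A /andP[_ xA]; rewrite setD1K.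
rewrite [X in X + _](eq_bigl (fun A => Q A && (x \notin A))); last first.
  move=> A; rewrite setU11 andbT; case: (boolP (x \in A)) => xA.
    rewrite andbF; apply/negP => /andP[_ /eqP e].
    by have := setD11 x (x |: A); rewrite e xA.
  by rewrite hQ // setU1K // eqxx.
rewrite (eq_bigr (fun A => - f A)) ?sumrN ?addNr // => A /andP[QA xA].
exact: hf.
Qed.

Lemma alt_sum_interval (R : pzRingType) A C : A \subset C ->
  \sum_(B : {set T} | (A \subset B) && (B \subset C)) (-1) ^+ #|C :\: B| =
  (A == C)%:R :> R.
Proof.
move=> sAC; case: eqP => [<-|/eqP neq].
  rewrite (big_pred1 A) ?setDv ?cards0 ?expr0 // => B.
  by rewrite /= eqEsubset andbC.
have [x xC xA] : exists2 x, x \in C & x \notin A.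
  apply/subsetPn; apply: contra neq => sCA; by rewrite eqEsubset sAC.
apply: (alt_toggle (x := x)) => B xB.
  rewrite subUset sub1set xC /=; congr (_ && _).
  rewrite -[in RHS](setU1K xB) subsetD1 xA andbT //.
move=> _; have -> : C :\: B = x |: (C :\: (x |: B)).
  apply/setP => y; rewrite !inE; case: eqP => [->|_] //=.
  by rewrite xC xB.
by rewrite cardsU1 !inE eqxx /= add1n exprS mulN1r opprK.
Qed.

Lemma alt_sum_sub (R : pzRingType) C :
  \sum_(A in powerset C) (-1) ^+ #|A| = (C == set0)%:R :> R.
Proof.
case: (set_0Vmem C) => [->|[x xC]].
  by rewrite powerset0 big_set1 cards0 eqxx.
have -> : (C == set0) = false by apply/negbTE/set0Pn; exists x.
apply: (alt_toggle (x := x)) => B xB; rewrite ?powersetE ?subUset ?sub1set ?xC //.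
by rewrite cardsU1 xB add1n exprS mulN1r.
Qed.

(* The characteristic polynomial of the interval [F, G]: the contraction of F
   in the localization at G. *)
Definition chi M F G : {poly int} :=
  \sum_(S : {set T} | (F \subset S) && (S \subset G))
     (-1) ^+ #|S :\: F| *: 'X^(rk M G - rk M S).

Lemma chi_loc M F : F \subset ground M ->
  char_poly_matroid (localization M F) = chi M set0 F.
Proof.
move=> sF; rewrite /char_poly_matroid /chi /rank /= (setIidPr sF).
apply: eq_big => A; rewrite ?powersetE ?sub0set //= => sA.
by rewrite setD0 !rk_loc setIid (setIidPl sA).
Qed.

Lemma chi_loc_con M F G : F \subset G -> G \subset ground M ->
  char_poly_matroid (localization (contraction M F) (G :\: F)) = chi M F G.
Proof.
move=> sFG sG; rewrite /char_poly_matroid /chi.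
have eg : ground (localization (contraction M F) (G :\: F)) = G :\: F.
  by rewrite /= -setDIl (setIidPr sG).
rewrite /rank eg.
rewrite [RHS](reindex_onto (fun A => A :|: F) (fun S => S :\: F)) /=; last first.
  by move=> S /andP[sFS _]; rewrite setUC -{1}(setIidPr sFS) setID.
apply: eq_big => A.
  rewrite powersetE subsetD subUset sFG subsetUr /= andbT; congr (_ && _).
  rewrite setDUl setDv setU0; exact/setDidPl/eqP.
rewrite powersetE subsetD => /andP[sA dA].
have -> : (A :|: F) :\: F = A by rewrite setDUl setDv setU0; apply/setDidPl.
rewrite !rk_loc !rk_con setIid (setIidPl _) ?subsetD ?sA //.
rewrite [G :\: F :|: F]setUC -{1}(setIidPr sFG) setID.
congr (_ *: 'X^ _).
have := rk_mono M (subsetUr A F); have : (rk M (A :|: F) <= rk M G)%N.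
  by rewrite rk_mono // subUset sA.
lia.
Qed.

Lemma chi_nonflat M F G : F \subset G -> flat M G -> ~~ flat M F -> chi M F G = 0.
Proof.
move=> sFG /flatP[sG hG] /nonflatP[]; first exact: subset_trans sG.
move=> x; rewrite inE => /andP[xF xE] e.
have xG : x \in G.
  by apply: contraT => xG; have := hG x xE xG; rewrite (rk_eqU sFG e) ltnn.
apply: (alt_toggle (x := x)) => S xS.
  rewrite subUset sub1set xG /=; congr (_ && _).
  by rewrite -[in RHS](setU1K xS) subsetD1 xF andbT.
move=> /andP[sFS sSG]; rewrite (rk_eqU sFS e) -scaleNr; congr (_ *: _).
have -> : (x |: S) :\: F = x |: (S :\: F).
  by apply/setP => y; rewrite !inE; case: eqP => [->|] //=; rewrite xF.
by rewrite cardsU1 !inE (negbTE xS) andbF add1n exprS mulN1r.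
Qed.

Lemma sum_chi M A G : A \subset G -> flat M G ->
  \sum_(F in flats M | (A \subset F) && (F \subset G)) chi M F G =
  'X^(rk M G - rk M A).
Proof.
move=> sAG fG.
transitivity (\sum_(F : {set T} | (A \subset F) && (F \subset G)) chi M F G).
  rewrite [RHS](bigID (flat M)) /= [X in _ + X]big1 ?addr0; last first.
    by move=> F /andP[/andP[_ sFG] nF]; apply: chi_nonflat.
  by apply: eq_bigl => F; rewrite inE andbC.
rewrite /chi (exchange_big_dep (fun S => (A \subset S) && (S \subset G))) /=; last first.
  by move=> F S /andP[sAF _] /andP[sFS ->]; rewrite (subset_trans sAF).
rewrite (bigD1 A) /=; last by rewrite subxx sAG.
rewrite [X in _ + X]big1 ?addr0.
  rewrite (big_pred1 A) ?setDv ?cards0 ?expr0 ?scale1r // => F /=.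
  rewrite eqEsubset sAG andbT [RHS]andbC.
  case: (boolP (F \subset A)) => sFA; rewrite ?andbF //.
  by rewrite (subset_trans sFA sAG) !andbT.
move=> S /andP[/andP[sAS sSG] neq].
rewrite -scaler_suml.
rewrite (eq_bigl (fun F => (A \subset F) && (F \subset S))); last first.
  move=> F; rewrite sSG andbT; case: (boolP (F \subset S)) => h; rewrite ?andbF //.
  by rewrite (subset_trans h sSG) !andbT.
by rewrite alt_sum_interval // eq_sym (negbTE neq) scale0r.
Qed.

Lemma rev_chi M F : rev_poly (rk M F) (chi M set0 F) =
  \sum_(A in powerset F) (-1) ^+ #|A| *: 'X^(rk M A).
Proof.
rewrite rev_poly_sum; apply: eq_big => A; rewrite ?powersetE ?sub0set //= => sA.
rewrite setD0 rev_polyZ rev_polyXn ?leq_subr // subKn //.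
exact: rk_mono.
Qed.

Lemma kernel M G : flat M G ->
  \sum_(F in flats M | F \subset G) rev_poly (rk M F) (chi M set0 F) * chi M F G
  = (G == set0)%:R.
Proof.
move=> fG; under eq_bigr => F _ do rewrite rev_chi big_distrl /=.
rewrite (exchange_big_dep (fun A => A \in powerset G)) /=; last first.
  by move=> F A /andP[_ sF]; rewrite !powersetE => /subset_trans; apply.
transitivity (\sum_(A in powerset G) (-1) ^+ #|A| *: ('X^(rk M G) : {poly int})).
  apply: eq_bigr => A; rewrite powersetE => sA.
  rewrite -big_distrr /= (eq_bigl (fun F => (F \in flats M) && ((A \subset F) && (F \subset G)))); last first.
    by move=> F; rewrite powersetE -andbA; congr (_ && _); rewrite andbC.
  by rewrite sum_chi // -scalerAl -exprD subnKC // rk_mono.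
rewrite -scaler_suml alt_sum_sub; case: eqP => [->|_]; rewrite ?scale0r //.
by rewrite rk0 scale1r.
Qed.

Lemma size_chi M F G : F \subset G -> (size (chi M F G) <= (rk M G - rk M F).+1)%N.
Proof.
move=> sFG; apply: leq_trans (size_sum _ _ _) _; apply/bigmax_leqP => S /andP[sFS _].
apply: leq_trans (size_scale_leq _ _) _; rewrite size_polyXn ltnS leq_sub2l //.
exact: rk_mono.
Qed.

Lemma con0 M : contraction M set0 = M.
Proof.
by apply: matroid_eq => [|A] /=; rewrite ?setD0 // rk_con setU0 rk0 subn0.
Qed.

Lemma con_con M F G : F \subset G ->
  contraction (contraction M F) (G :\: F) = contraction M G.
Proof.
move=> sFG; have e : G :\: F :|: F = G.
  by rewrite setUC -{1}(setIidPr sFG) setID.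
apply: matroid_eq => [|A] /=.
  by rewrite setDDl setUC e.
rewrite !rk_con -setUA e; have := rk_mono M (subsetUr A G).
have := rk_mono M sFG; lia.
Qed.

Lemma rank_con M F : F \subset ground M -> rank (contraction M F) = (rank M - rk M F)%N.
Proof. by move=> sF; rewrite /rank rk_con /= setUC -{1}(setIidPr sF) setID. Qed.

Lemma flatE M : flat M (ground M).
Proof. by apply/flatP; split=> // x ->. Qed.

Lemma flat0 M F : flat M F -> ~~ flat M set0 -> chi M set0 F = 0.
Proof. by move=> fF; apply: chi_nonflat => //; apply: sub0set. Qed.

Lemma chi00 M : chi M set0 set0 = 1.
Proof.
rewrite /chi (big_pred1 set0) => [|S]; last by rewrite /= sub0set subset0.
by rewrite setDv cards0 subnn scale1r.
Qed.

Lemma flats_rank0 M : rank M = 0%N -> flats M = [set ground M].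
Proof.
move=> r0; apply/setP => F; rewrite !inE; apply/idP/eqP => [|->]; last exact: flatE.
move=> /flatP[sF h]; apply/eqP; rewrite eqEsubset sF; apply/subsetP => x xE.
apply: contraT => /(h _ xE); have : (rk M (x |: F) <= rank M)%N.
  by rewrite rk_mono // subUset sub1set xE.
by rewrite r0; case: (rk _ _).
Qed.

Lemma sum_con M F (f : {set T} -> {poly int}) : flat M F ->
  \sum_(G in flats (contraction M F)) f G =
  \sum_(G in flats M | F \subset G) f (G :\: F).
Proof.
move=> fF; have [sF _] := flatP _ _ fF.
rewrite [RHS](reindex_onto (fun G => G :|: F) (fun G => G :\: F)) /=; last first.
  by move=> G /andP[_ sFG]; rewrite setUC -{1}(setIidPr sFG) setID.
apply: eq_big => G.
  rewrite !inE flat_contraction // subsetUr andbT andbC; congr (_ && _).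
  rewrite setDUl setDv setU0; exact/setDidPl/eqP.
rewrite inE flat_contraction // => /andP[d _].
by rewrite setDUl setDv setU0; congr f; apply/esym/setDidPl.
Qed.

Fixpoint kl_rec n M : {poly int} :=
  if n is n'.+1 then
    if rank M == 0%N then (ground M == set0)%:R else
    \poly_(i < uphalf (rank M))
      (\sum_(F in flats M | F != set0) chi M set0 F * kl_rec n' (contraction M F))`_(rank M - i)
  else 0.

Definition kl M := kl_rec #|ground M|.+1 M.

Definition klR M :=
  \sum_(F in flats M | F != set0) chi M set0 F * kl (contraction M F).

Lemma con_lt M F : flat M F -> F != set0 ->
  (#|ground (contraction M F)| < #|ground M|)%N.
Proof.
move=> /flatP[sF _] /set0Pn[x xF] /=; apply: proper_card.
rewrite properEneq subsetDl andbT; apply/eqP => /setP/(_ x).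
by rewrite inE xF /= (subsetP sF).
Qed.

Lemma kl_rec_stable n m M : (#|ground M| < n)%N -> (#|ground M| < m)%N ->
  kl_rec n M = kl_rec m M.
Proof.
elim: n m M => [|n IH] [|m] M //= hn hm; case: ifP => // _.
apply: eq_poly => i _; congr ((polyseq _)`_ _); apply: eq_bigr => F.
rewrite inE => /andP[fF F0]; congr (_ * _).
by apply: IH; apply: leq_trans (con_lt fF F0) _.
Qed.

Lemma klE M : kl M = if rank M == 0%N then (ground M == set0)%:R else
    \poly_(i < uphalf (rank M)) (klR M)`_(rank M - i).
Proof.
rewrite {1}/kl /=; case: ifP => // _; apply: eq_poly => i _.
congr ((polyseq _)`_ _); apply: eq_bigr => F; rewrite inE => /andP[fF F0].
by congr (_ * _); apply: kl_rec_stable => //; apply: con_lt.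
Qed.

Lemma size_kl M : (size (kl M) <= (rank M).+1)%N.
Proof.
rewrite klE; case: eqP => [->|_]; first by case: (_ == _); rewrite ?size_poly1 ?size_poly0.
by apply: leq_trans (size_poly _ _) _; lia.
Qed.

Lemma size_klR M : (size (klR M) <= (rank M).+1)%N.
Proof.
apply: leq_trans (size_sum _ _ _) _; apply/bigmax_leqP => F; rewrite inE.
move=> /andP[/flatP[sF _] _]; apply: leq_trans (size_polyMleq _ _) _.
have := size_chi M (sub0set F); have := size_kl (contraction M F).
rewrite rank_con // rk0; have := rk_mono M sF; rewrite -/(rank M); lia.
Qed.

Definition kl_eq M := rev_poly (rank M) (kl M) =
  \sum_(F in flats M) chi M set0 F * kl (contraction M F).

Lemma rev_klR M : flat M set0 ->
  (forall F, flat M F -> F != set0 -> kl_eq (contraction M F)) ->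
  rev_poly (rank M) (klR M) = - klR M.
Proof.
move=> f0 IH; rewrite rev_poly_sum.
transitivity (\sum_(F in flats M | F != set0) \sum_(G in flats M | F \subset G)
  rev_poly (rk M F) (chi M set0 F) * chi M F G * kl (contraction M G)).
  apply: eq_bigr => F; rewrite inE => /andP[fF F0].
  have [sF _] := flatP _ _ fF.
  have -> : rank M = (rk M F + rank (contraction M F))%N.
    by rewrite rank_con // subnKC // rk_mono.
  rewrite rev_polyM ?size_kl //; last by have := size_chi M (sub0set F); rewrite rk0 subn0.
  rewrite (IH _ fF F0) sum_con // big_distrr /=; apply: eq_bigr => G.
  rewrite inE => /andP[/flatP[sG _] sFG]; rewrite -mulrA con_con //.
  congr (_ * (_ * _)); rewrite -chi_loc; last by rewrite /= setSD.
  by rewrite chi_loc_con.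
rewrite (exchange_big_dep (fun G => (G \in flats M) && (G != set0))) /=; last first.
  move=> F G /andP[_ F0] /andP[-> sFG]; apply: contra F0 => /eqP G0.
  by rewrite -subset0 -G0.
rewrite /klR -sumrN; apply: eq_bigr => G; rewrite inE => /andP[fG G0].
rewrite -big_distrl /= -mulNr; congr (_ * _).
have := kernel fG; rewrite (negbTE G0) (bigD1 set0) /=; last by rewrite inE f0 sub0set.
rewrite rk0 chi00.
have -> : rev_poly 0 1 = 1 by rewrite -[1]/('X^0 : {poly int}) rev_polyXn.
rewrite mul1r => /eqP; rewrite addrC addr_eq0 => /eqP <-; apply: eq_bigl => F.
by rewrite fG /= andbAC.
Qed.

Lemma kl_eqP M : kl_eq M.
Proof.
have [n] := ubnP #|ground M|; elim: n M => // n IH M /ltnSE hn.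
rewrite /kl_eq; case: (posnP (rank M)) => [r0|rpos].
  rewrite flats_rank0 // big_set1 -chi_loc // r0 [kl (contraction _ _)]klE.
  rewrite rank_con // subnn /= setDv !eqxx mulr1 klE r0 eqxx.
  rewrite chi_loc //.
  rewrite (_ : chi _ _ _ = (ground M == set0)%:R); last first.
    rewrite -alt_sum_sub; apply: eq_big => A; rewrite ?powersetE ?sub0set //= => sA.
    rewrite setD0 -[rk M (ground M)]/(rank M) r0 sub0n expr0.
    by rewrite -mul_polyC mulr1 rmorphXn rmorphN1.
  apply/polyP => -[|i]; rewrite coef_rev //=.
  by case: (_ == _); rewrite ?coef1 ?coef0.
have IH' F : flat M F -> F != set0 -> kl_eq (contraction M F).
  by move=> fF F0; apply: IH; apply: leq_trans (con_lt fF F0) _.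
have [f0|nf0] := boolP (flat M set0); last first.
  rewrite big1 => [|F]; last by rewrite inE => fF; rewrite flat0 // mul0r.
  rewrite klE gtn_eqF // /klR big1 => [|F /andP[]]; last first.
    by rewrite inE => fF _; rewrite flat0 // mul0r.
  by apply/polyP => i; rewrite coef_rev coef_poly !coef0 if_same if_same.
rewrite (bigD1 set0) ?inE //= con0 chi00 mul1r -/(klR M).
have aR i : (i <= rank M)%N -> (klR M)`_(rank M - i) = - (klR M)`_i.
  by move=> h; have /polyP/(_ i) := rev_klR f0 IH'; rewrite coef_rev h coefN.
apply/polyP => i; rewrite coefD coef_rev klE gtn_eqF // !coef_poly.
case: (leqP i (rank M)) => hi; last first.
  rewrite (_ : (i < uphalf (rank M))%N = false); last by lia.
  by rewrite add0r nth_default // (leq_trans (size_klR M)).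
rewrite subKn //; have := aR i hi.
case: ifP => h1; case: ifP => h2 e.
- lia.
- by rewrite add0r.
- by rewrite e addNr.
- have e2 : (rank M - i)%N = i by lia.
  by move: e; rewrite e2; lia.
Qed.

Theorem KL_exists : exists P : matroid T -> {poly int}, KL_assignment P.
Proof.
exists kl => M; split.
- by move=> r0; rewrite klE r0 eqxx; case: (_ == _).
- move=> rpos; rewrite klE gtn_eqF //.
  have := size_poly (uphalf (rank M)) (fun i => (klR M)`_(rank M - i)); lia.
- rewrite [LHS]kl_eqP; apply: eq_bigr => F; rewrite inE => /flatP[sF _].
  by rewrite chi_loc.
Qed.

Lemma KL_size P M : KL_assignment P -> (size (P M) <= (rank M).+1)%N.
Proof.
move=> hP; have [h1 h2 _] := hP M; case: (posnP (rank M)) => [r0|/h2]; last lia.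
by rewrite h1 //; case: ifP; rewrite ?size_poly1 ?size_poly0.
Qed.

Theorem KL_unique (P Q : matroid T -> {poly int}) :
  KL_assignment P -> KL_assignment Q -> P =1 Q.
Proof.
move=> hP hQ M; have [n] := ubnP #|ground M|; elim: n M => // n IH M /ltnSE hn.
have [p1 p2 p3] := hP M; have [q1 q2 q3] := hQ M.
case: (posnP (rank M)) => [r0|rpos]; first by rewrite p1 ?q1.
have {}IH F : flat M F -> F != set0 -> P (contraction M F) = Q (contraction M F).
  by move=> fF F0; apply: IH; apply: leq_trans (con_lt fF F0) _.
have [f0|nf0] := boolP (flat M set0); last first.
  have z R : \sum_(F in flats M) char_poly_matroid (localization M F) * R (contraction M F) = 0.
    rewrite big1 // => F; rewrite inE => fF; have [sF _] := flatP _ _ fF.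
    by rewrite chi_loc // flat0 // mul0r.
  move: p3 q3; rewrite !z => p3 q3.
  by rewrite -(rev_polyK (KL_size M hP)) p3 -q3 rev_polyK // KL_size.
have hi i : (rank M <= 2 * i)%N -> (P M)`_i = 0 /\ (Q M)`_i = 0.
  move=> h; have z (p : {poly int}) : (2 * (size p).-1 < rank M)%N -> p`_i = 0.
    by move=> k; apply: nth_default; move: k; case: (size p) => [|s] /=; lia.
  by split; apply: z; [apply: p2 | apply: q2].
suff e i : (rank M <= 2 * i)%N -> (i <= rank M)%N ->
    (P M)`_(rank M - i) = (Q M)`_(rank M - i).
  apply/polyP => i; have [/hi[-> ->]//|h] := leqP (rank M) (2 * i).
  by have := e (rank M - i)%N; rewrite subKn; [apply; lia|lia].
move=> h h'; have [Pi Qi] := hi i h.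
have := congr1 (fun p => p`_i) p3; have := congr1 (fun p => p`_i) q3.
rewrite !coef_rev h' !(bigD1 set0 (P := fun F => F \in flats M)) ?inE //= !con0 chi_loc ?sub0set //.
rewrite chi00 !mul1r !coefD Pi Qi !add0r => -> ->; congr ((polyseq _)`_ _).
by apply: eq_bigr => F /andP[]; rewrite inE => fF F0; rewrite IH.
Qed.

Lemma Z_palindromic P M : KL_assignment P ->
  rev_poly (rank M) (Z_poly P M) = Z_poly P M.
Proof.
move=> hP; rewrite rev_poly_sum.
transitivity (\sum_(F in flats M) \sum_(G in flats M | F \subset G)
   chi M F G * P (contraction M G)).
  apply: eq_bigr => F; rewrite inE => fF; have [sF _] := flatP _ _ fF.
  have -> : rank M = (rk M F + rank (contraction M F))%N.
    by rewrite rank_con // subnKC // rk_mono.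
  rewrite rev_polyM ?size_polyXn ?KL_size // rev_polyXn // subnn expr0 mul1r.
  have [_ _ ->] := hP (contraction M F); rewrite sum_con //; apply: eq_bigr => G.
  by rewrite inE => /andP[/flatP[sG _] sFG]; rewrite con_con // chi_loc_con.
rewrite (exchange_big_dep (fun G => G \in flats M)) /=; last by move=> ? ? _ /andP[].
apply: eq_bigr => G fG; rewrite -big_distrl /=; congr (_ * _).
have fG' : flat M G by rewrite inE in fG.
have := sum_chi (sub0set G) fG'; rewrite rk0 subn0 => <-.
by apply: eq_bigl => F; rewrite fG sub0set.
Qed.

Lemma size_Z P M : KL_assignment P -> (size (Z_poly P M) <= (rank M).+1)%N.
Proof.
move=> hP; apply: leq_trans (size_sum _ _ _) _; apply/bigmax_leqP => F; rewrite inE.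
move=> /flatP[sF _]; apply: leq_trans (size_polyMleq _ _) _.
rewrite size_polyXn; have := KL_size (contraction M F) hP.
rewrite rank_con //; have := rk_mono M sF; rewrite -/(rank M); lia.
Qed.

Definition gsum d (g : {poly int}) : {poly int} :=
  \sum_(i < d./2.+1) g`_i *: ('X^i * (1 + 'X) ^+ (d - 2 * i)).

Lemma gsum_rec d (g : {poly int}) a :
  gsum d.+2 (g * 'X + a%:P) = gsum d g * 'X + a *: (1 + 'X) ^+ d.+2.
Proof.
rewrite /gsum /= big_ord_recl coefD coefMX coefC /= add0r mul1r addrC.
congr (_ + _); rewrite big_distrl /=; apply: eq_bigr => i _.
rewrite coefD coefMX coefC /= addr0 -scalerAl; congr (_ *: _).
by rewrite mulrAC -exprSr; congr (_ * _ ^+ _); rewrite /bump; lia.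
Qed.

Lemma poly_split (p : {poly int}) : exists q a, p = q * 'X + a%:P.
Proof.
elim/poly_ind: p => [|p c _]; last by exists p, c.
by exists 0, 0; rewrite mul0r add0r.
Qed.

Lemma rev_1X d : rev_poly d ((1 + 'X) ^+ d) = (1 + 'X) ^+ d.
Proof.
have e : (1 + 'X : {poly int}) = 'X + 1%:P by rewrite addrC.
elim: d => [|d IH]; first by rewrite expr0 -[1]/('X^0 : {poly int}) rev_polyXn.
have s1 : (size (1 + 'X : {poly int})%R <= 2)%N by rewrite e size_XaddC.
have sd : (size ((1 + 'X : {poly int}) ^+ d)%R <= d.+1)%N.
  by apply: leq_trans (size_poly_exp_leq _ _) _; rewrite e size_XaddC mul1n.
rewrite exprS -[d.+1]add1n rev_polyM // IH; congr (_ * _).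
by apply/polyP => i; rewrite coef_rev !coefD !coef1 !coefX; case: i => [|[|]].
Qed.

Lemma coef0_1X n : ((1 + 'X : {poly int}) ^+ n)`_0 = 1.
Proof. by rewrite -horner_coef0 hornerE !hornerE expr1n. Qed.

Lemma size_1X n : (size ((1 + 'X : {poly int}) ^+ n)%R <= n.+1)%N.
Proof. by rewrite -rev_1X size_rev. Qed.

Lemma gamma_exists_pal d p : (size p <= d.+1)%N -> rev_poly d p = p ->
  exists g, is_gamma_poly d p g.
Proof.
elim/ltn_ind: d p => d IH p sp pal.
case: (ltnP d 2) => [d2|d2].
  have d0 : (d./2 = 0)%N by case: d d2 {IH sp pal} => [|[]].
  exists (p`_0)%:P; split; first by rewrite d0 size_polyC; case: (_ != _).
  rewrite d0 big_ord1 coefC /= mul1r subn0.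
  case: d d2 sp pal {IH d0} => [|[|]] // _ sp pal.
    by rewrite alg_polyC; apply: size1_polyC.
  apply/polyP => i; rewrite -{1}pal coef_rev coefZ expr1 coefD coef1 coefX.
  case: i => [|[|i]] /=; rewrite ?addr0 ?add0r ?mulr1 ?mulr0 ?subnn //.
  by have := congr1 (fun q : {poly int} => q`_0) pal; rewrite coef_rev.
case: d d2 IH sp pal => [|[|d]] // _ IH sp pal.
pose u := p - p`_0 *: (1 + 'X) ^+ d.+2.
have su : (size u <= d.+3)%N.
  apply: leq_trans (size_polyD _ _) _; rewrite geq_max sp size_polyN.
  exact: leq_trans (size_scale_leq _ _) (size_1X _).
have pu : rev_poly d.+2 u = u.
  by rewrite /u -scaleNr rev_polyD rev_polyZ rev_1X pal.
have [q [a eq]] := poly_split u.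
have u0 : u`_0 = 0 by rewrite coefB coefZ coef0_1X mulr1 subrr.
have a0 : a = 0 by move: u0; rewrite eq coefD coefMX coefC add0r.
move: eq; rewrite a0 addr0 => eq.
have qi i : q`_i = u`_i.+1 by rewrite eq coefMX.
have ud i : (d.+2 <= i)%N -> u`_i = 0.
  rewrite leq_eqVlt => /orP[/eqP<-|h]; last by rewrite nth_default // (leq_trans su).
  by rewrite -pu coef_rev leqnn subnn.
have sq : (size q <= d.+1)%N by apply/leq_sizeP => j hj; rewrite qi ud.
have pq : rev_poly d q = q.
  apply/polyP => i; rewrite coef_rev; case: leqP => h; last by rewrite qi ud.
  by rewrite !qi -[in RHS]pu coef_rev subSS ltnS leqW // subSn.
have [|g [sg eg]] := IH d _ q sq pq; first by lia.
exists (g * 'X + (p`_0)%:P); split.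
  by rewrite size_MXaddC; case: ifP => //= _; rewrite ltnS.
rewrite -/(gsum _ _) gsum_rec /gsum -eg -eq /u; ring.
Qed.

Theorem gamma_exists P M : KL_assignment P ->
  exists g, is_gamma_poly (rank M) (Z_poly P M) g.
Proof. by move=> hP; apply: gamma_exists_pal (size_Z M hP) (Z_palindromic M hP). Qed.

Theorem gamma_unique d Z g h :
  is_gamma_poly d Z g -> is_gamma_poly d Z h -> g = h.
Proof.
case=> sg -> [sh]; rewrite -!/(gsum _ _).
elim/ltn_ind: d g h sg sh => d IH g h sg sh e.
case: (ltnP d 2) => [d2|d2].
  have d0 : (d./2 = 0)%N by case: d d2 {IH sg sh e} => [|[]].
  move: sg sh e; rewrite /gsum !d0 !big_ord1 mul1r => sg sh /(congr1 (fun p => p`_0)).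
  rewrite !coefZ coef0_1X !mulr1 => e.
  by rewrite (size1_polyC sg) (size1_polyC sh) e.
case: d d2 IH sg sh e => [|[|d]] // _ IH.
have [g' [a ->]] := poly_split g; have [h' [b ->]] := poly_split h.
have aux (q : {poly int}) c : (size (q * 'X + c%:P)%R <= d.+2./2.+1)%N -> (size q <= d./2.+1)%N.
  by rewrite size_MXaddC; case: eqP => [->|//]; rewrite size_poly0.
rewrite !gsum_rec => /aux sg /aux sh e.
have ab : a = b.
  move/(congr1 (fun p => p`_0)): e.
  by rewrite !coefD !coefMX !coefZ coef0_1X !mulr1 !add0r.
rewrite ab in e *; move/addIr: e => /(mulIf (negbT (polyX_eq0 _))) e.
by rewrite (IH d _ g' h').
Qed.

End WellDefinedness.

(* Main.v *)
Require Import Defs.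
From mathcomp Require Import all_boot all_order all_algebra.
From mathcomp Require Import zify ring.

Import GRing.Theory Num.Theory.
Local Open Scope ring_scope.

(** A sparse paving matroid of rank [k] on [k + m] elements is determined by the
    family of its circuit-hyperplanes, and contracting a set of fewer than [k]
    elements gives a sparse paving matroid with the same [m].  Since [Z] is
    palindromic and [P] has degree less than [k / 2], induction on the rank
    yields [P = uniform_P m k - lam *: relax_P k] and
    [Z = uniform_Z m k - lam *: relax_Z k], with [lam] the number of
    circuit-hyperplanes.  The [i]-th gamma coefficient of [uniform_Z m k] is
    [\sum_(h < m) 'C(k + h, 2 i + h) D(i, h)] for [i > 0], where [D(i, h)] is the
    number of dissections of an [(i + h + 2)]-gon by [i - 1] diagonals, and that
    of [relax_Z k] is ['C(k - 1, 2 i - 1) D(i, 0)].  Two circuit-hyperplanes meet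
    in at most [k - 2] elements, so double counting bounds both [(k + 1) lam] and
    [(m + 1) lam] by ['C(k + m, k)]; an induction on [m], with the first bound
    for [m <= k] and the second for [m >= k], then gives nonnegativity. *)

(** * Uniform matroids *)

(** Both sides count the ordered pairs of disjoint subsets of sizes [a] and [b]. *)
Lemma bin_trinomial n a b : ('C(n, a) * 'C(n - a, b) = 'C(n, b) * 'C(n - b, a))%N.
Proof.
have [ab|ab] := leqP (a + b) n; last first.
  have z x y : (n < x + y)%N -> ('C(n, x) * 'C(n - x, y) = 0)%N.
    move=> h; have [/bin_small->//|xn] := ltnP n x.
    by rewrite (@bin_small (n - x)) ?muln0 //; lia.
  by rewrite !z // addnC.
have e x y : (x + y <= n)%N ->
    ('C(n, x) * 'C(n - x, y) * (x`! * y`! * (n - x - y)`!) = n`!)%N.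
  move=> h; rewrite -(@bin_fact n x) ?(leq_trans (leq_addr _ _) h) //.
  rewrite -(@bin_fact (n - x) y) ?leq_subRL ?(leq_trans (leq_addr _ _) h) //.
  by lia.
apply/eqP; rewrite -(@eqn_pmul2r (a`! * b`! * (n - a - b)`!)).
  by rewrite e // subnAC [(a`! * _)%N]mulnC e // addnC.
by rewrite !muln_gt0 !fact_gt0.
Qed.

Lemma mul_bin_bin n a b : (b <= a)%N ->
  ('C(n, a) * 'C(a, b) = 'C(n, b) * 'C(n - b, a - b))%N.
Proof.
move=> ba; have [na|an] := ltnP n a.
  rewrite (bin_small na); have [/bin_small->//|bn] := ltnP n b.
  by rewrite (@bin_small (n - b)) ?muln0 //; lia.
rewrite -bin_sub // -{2}(subKn an) bin_trinomial; congr (_ * _)%N.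
by rewrite -bin_sub; [congr 'C(_, _); lia | lia].
Qed.

(** Kirkman-Cayley numbers.  The division is exact for [i > 0], and the value at
    [i = 0] is [0]. *)
Definition dissections (i h : nat) : nat :=
  (('C(2 * i + h, i.-1) * 'C((i + h).-1, h)) %/ i)%N.

(** With [i = n.+1], both [(n + 2 + h) * (x * y)] and [h * (x * y)] are divisible by [n.+1], by
    [e1'] and [e2']; hence so is [x * y]. *)
Lemma mul_dissections i h : (0 < i)%N ->
  (i * dissections i h = 'C(2 * i + h, i.-1) * 'C((i + h).-1, h))%N.
Proof.
case: i => // n _; rewrite /dissections mulnC divnK //= addSn /=.
have e1 := mul_bin_left (2 * n.+1 + h) n.
have e2 := mul_bin_left (n + h) n.
have -> : ('C(n + h, h) = 'C(n + h, n))%N by rewrite -bin_sub ?leq_addl // addnK.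
set x := 'C(_, n) in e1 *; set y := 'C(_, n) in e2 *.
have e1' : ((n.+1 * 'C(2 * n.+1 + h, n.+1)) * y = (n + 2 + h) * (x * y))%N.
  by rewrite e1 mulnA; congr (_ * _ * _)%N; lia.
have e2' : (x * (n.+1 * 'C(n + h, n.+1)) = h * (x * y))%N.
  by rewrite e2 mulnCA; congr (_ * _)%N; lia.
have : (n.+1 %| n.+1 * (x * y) + (h * (x * y) + x * y))%N.
  by rewrite (_ : _ + _ = (n + 2 + h) * (x * y))%N; [rewrite -e1' -mulnA dvdn_mulr | lia].
have hx : (n.+1 %| h * (x * y))%N by rewrite -e2' dvdn_mull // dvdn_mulr.
by rewrite (dvdn_addr _ (dvdn_mulr _ (dvdnn _))) (dvdn_addr _ hx).
Qed.

Definition uniform_gamma (m k i : nat) : nat :=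
  ((i == 0) + \sum_(h < m) 'C(k + h, 2 * i + h) * dissections i h)%N.

Definition uniform_Z (m k : nat) : {poly int} :=
  \sum_(i < k./2.+1) (uniform_gamma m k i)%:R *: ('X^i * (1 + 'X) ^+ (k - 2 * i)).

(** [uniform_P m k] is the Kazhdan-Lusztig polynomial of the uniform matroid of
    rank [k] on [k + m] elements; [uniform_PS] is its deletion formula. *)
Definition uniform_step (m k : nat) : {poly int} :=
  \poly_(i < k./2.+1) ('C(k + m, 2 * i + m) * dissections i m)%:R.

Fixpoint uniform_P (m k : nat) : {poly int} :=
  if m is m'.+1 then
    (fix P k := if k is k'.+1 then uniform_P m' k - 'X * P k' + uniform_step m' k
                else 0) k
  else (0 < k)%:R.

#[global] Arguments uniform_P : simpl never.

Lemma uniform_PS m k :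
  uniform_P m.+1 k.+1 =
    uniform_P m k.+1 - 'X * uniform_P m.+1 k + uniform_step m k.+1.
Proof. by []. Qed.

(** The value [0] in rank zero, even for the empty matroid, discards the last term when a sum over
    [uniform_P m (k - i)] is shifted. *)
Lemma uniform_P0 m : uniform_P m 0 = 0.
Proof. by case: m. Qed.

Lemma coef_step m k j :
  (uniform_step m k)`_j = ('C(k + m, 2 * j + m) * dissections j m)%:R.
Proof.
rewrite coef_poly; case: ltnP => // h; rewrite bin_small //.
by lia.
Qed.

Lemma dissections0 h : dissections 0 h = 0%N.
Proof. by rewrite /dissections divn0. Qed.

Lemma uniform_ZS m k : uniform_Z m.+1 k = uniform_Z m k +
  \sum_(l < k./2.+1) ('C(k + m, 2 * l + m) * dissections l m)%:R *:
     ('X^l * (1 + 'X) ^+ (k - 2 * l)).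
Proof.
rewrite /uniform_Z -big_split /=; apply: eq_bigr => i _.
by rewrite -scalerDl -natrD /uniform_gamma big_ord_recr /= addnA.
Qed.

Lemma uniform_Z0 k : uniform_Z 0 k = (1 + 'X) ^+ k.
Proof.
rewrite /uniform_Z big_ord_recl /uniform_gamma big_ord0 /= scale1r mul1r subn0.
by rewrite big1 ?addr0 // => i _; rewrite big_ord0 scale0r.
Qed.

(** The binomial theorem expands [(1 + 'X) ^+ (k - 2 * l)], and [bin_trinomial] matches the
    coefficients. *)
Lemma step_sum m k :
  \sum_(i < k) 'C(k + m, i)%:R *: ('X^i * uniform_step m (k - i)) =
  \sum_(l < k./2.+1) ('C(k + m, 2 * l + m) * dissections l m)%:R *:
     ('X^l * (1 + 'X) ^+ (k - 2 * l)).
Proof.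
have step i : (i <= k)%N -> uniform_step m (k - i) = \sum_(l < k./2.+1)
    ('C(k - i + m, 2 * l + m) * dissections l m)%:R *: 'X^l.
  move=> ik; rewrite -(poly_def _ (fun l => ('C(k - i + m, 2 * l + m) * dissections l m)%:R)).
  apply/polyP => j; rewrite coef_step coef_poly.
  by case: ltnP => // h; rewrite bin_small //; lia.
transitivity (\sum_(i < k) \sum_(l < k./2.+1)
   ('C(k + m, i) * ('C(k - i + m, 2 * l + m) * dissections l m))%:R *: 'X^(i + l) : {poly int}).
  apply: eq_bigr => i _; rewrite step; last exact: ltnW.
  rewrite big_distrr /= scaler_sumr; apply: eq_bigr => l _ /=.
  by rewrite -scalerAr scalerA -natrM -exprD.
rewrite exchange_big; apply: eq_bigr => l _ /=.
(* The left side lacks [i = k], which would matter only for [l = 0], where [dissections 0 m = 0]. *)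
case: (posnP l) => [l0|l0].
  rewrite big1 => [|i _]; rewrite l0 dissections0 ?muln0 ?scale0r //.
have hl := ltn_ord l.
have -> : (1 + 'X : {poly int}) ^+ (k - 2 * l) = \sum_(i < k) 'C(k - 2 * l, i)%:R *: 'X^i.
  rewrite exprDn.
  transitivity (\sum_(0 <= i < (k - 2 * l).+1) 'C(k - 2 * l, i)%:R *: 'X^i : {poly int}).
    by rewrite big_mkord; apply: eq_bigr => i _; rewrite expr1n mul1r scaler_nat.
  rewrite -(big_mkord xpredT (fun i => 'C(k - 2 * l, i)%:R *: 'X^i)).
  rewrite [RHS](big_cat_nat (n := (k - 2 * l).+1)) //=; last by lia.
  rewrite [X in _ = _ + X]big_nat_cond [X in _ = _ + X]big1 ?addr0 // => i.
  by rewrite andbT => /andP[hi _]; rewrite bin_small ?scale0r.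
rewrite big_distrr /= scaler_sumr; apply: eq_bigr => i _ /=.
rewrite -scalerAr -exprD scalerA -natrM [(l + i)%N]addnC; congr (_%:R *: _).
rewrite mulnA [in RHS]mulnAC; congr (_ * _)%N.
have hi := ltn_ord i.
have -> : (k - i + m = k + m - i)%N by lia.
by rewrite bin_trinomial; congr (_ * 'C(_, _))%N; lia.
Qed.

(** This is the sum over the flats of a uniform matroid: the ground set and all [i]-subsets with
    [i < k]. In the induction on [m], Pascal's rule absorbs the shifted term of [uniform_PS], and
    [step_sum] supplies the rest. *)
Lemma uniform_Z_rec m k : uniform_Z m k =
  'X^k + \sum_(i < k) 'C(k + m, i)%:R *: ('X^i * uniform_P m (k - i)).
Proof.
elim: m => [|m IH] in k *.
  rewrite uniform_Z0 exprDn big_ord_recr /= binn expr1n mul1r mulr1n addrC.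
  congr (_ + _); apply: eq_bigr => i _.
  by rewrite /uniform_P addn0 expr1n mul1r subn_gt0 ltn_ord mulr1 scaler_nat.
rewrite uniform_ZS IH -step_sum -addrA -big_split /=; congr (_ + _).
case: k => [|k]; first by rewrite !big_ord0.
transitivity (\sum_(i < k.+1) ('C(k.+1 + m, i)%:R *: ('X^i * uniform_P m.+1 (k.+1 - i)) +
    'C(k.+1 + m, i)%:R *: ('X^i * ('X * uniform_P m.+1 (k - i))))).
  apply: eq_bigr => i _; rewrite -!scalerDr -!mulrDr subSn -1?ltnS // uniform_PS.
  by congr (_ *: (_ * _)); ring.
rewrite big_split /= [X in _ + X]big_ord_recr /= subnn uniform_P0 !mulr0 scaler0 addr0.
rewrite big_ord_recl [RHS]big_ord_recl /= !bin0 -addrA; congr (_ + _).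
rewrite -big_split /=; apply: eq_bigr => i _.
rewrite /bump /= add1n subSS mulrA -exprSr -scalerDl -natrD.
by rewrite addnS [in RHS]binS addnC.
Qed.

(** [kl_sum m u j] is [u / 'C(u + j + m, j)] times the [j]-th coefficient of
    [uniform_P m (u + j)] when [m + j > 0]; it vanishes for [u <= j], whence the
    degree bound. *)
Definition kl_sum (m u j : nat) : nat :=
  (\sum_(h < m) 'C(u + h, (h + j).+1) * 'C((j + h).-1, h))%N.

Lemma kl_sumD m u j :
  (kl_sum m u j.+1 + kl_sum m.+1 u j = 'C(u + m, j.+1 + m) * 'C(j + m, m))%N.
Proof.
rewrite /kl_sum; elim: m => [|m IH].
  by rewrite big_ord0 big_ord1 !addn0 add0n !bin0.
rewrite big_ord_recr [in X in (_ + X)%N]big_ord_recr /= addnACA IH.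
rewrite !(addSn, addnS) /= [(m + j)%N]addnC [in RHS](binS (j + m)) mulnDr.
by rewrite addnA [LHS]addnC -mulnDl [('C(u + m, _.+1) + _)%N]addnC -binS.
Qed.

Lemma kl_sum_small m u j : (u <= j)%N -> kl_sum m u j = 0%N.
Proof. by move=> uj; rewrite /kl_sum big1 // => h _; rewrite bin_small //; lia. Qed.

Lemma kl_sum0 m u : kl_sum m.+1 u 0 = u.
Proof.
rewrite /kl_sum big_ord_recl big1 => [|h _]; first by rewrite /= !addn0 bin1 muln1.
by rewrite /= (@bin_small h) ?muln0.
Qed.

Lemma uniform_P_coef0 m k : (0 < k)%N -> (uniform_P m k)`_0 = 1.
Proof.
elim: m => [|m IH] in k *; first by rewrite /uniform_P => ->; rewrite coef1.
case: k => // k _; rewrite uniform_PS !coefD coefN coefXM coef_step IH //.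
by rewrite dissections0 muln0 oppr0 !addr0.
Qed.

Lemma size_uniform_P m k : (size (uniform_P m k) <= k)%N.
Proof.
elim: m => [|m IHm] in k *.
  by rewrite /uniform_P; case: k => [|k]; rewrite ?size_poly0 ?size_poly1.
elim: k => [|k IH]; first by rewrite uniform_P0 size_poly0.
apply/leq_sizeP => j jk; rewrite uniform_PS !coefD coefN coefXM coef_step.
rewrite bin_small ?(nth_default _ (leq_trans (IHm _) jk)); last by lia.
case: j jk => [|j] jk //=.
by rewrite nth_default ?oppr0 ?addr0 // (leq_trans IH).
Qed.

(** The deletion formula [uniform_PS] at rank [u + j.+1], multiplied by [u] and read at degree
    [j.+1], with the closed form of [uniform_P_coef] inserted. *)
Lemma kl_sum_rec m u j (N := (u + j.+1 + m)%N) :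
  ('C(N.+1, j.+1) * kl_sum m.+1 u j.+1 + 'C(N, j) * kl_sum m.+1 u j =
   'C(N, j.+1) * kl_sum m u j.+1 +
     u * ('C(N, 2 * j.+1 + m) * dissections j.+1 m))%N.
Proof.
have eK := kl_sumD m u j.
have eS : (kl_sum m.+1 u j.+1 =
           kl_sum m u j.+1 + 'C(u + m, (m + j.+1).+1) * 'C(j + m, m))%N.
  by rewrite /kl_sum big_ord_recr.
have eD := @mul_dissections j.+1 m isT.
rewrite addSn /= in eD.
have eT := @mul_bin_bin N (2 * j.+1 + m) j.
have {}eT : ('C(N, 2 * j.+1 + m) * 'C(2 * j.+1 + m, j) =
      'C(N, j) * ('C(u + m, (m + j.+1).+1) + 'C(u + m, m + j.+1)))%N.
  rewrite eT; last by lia.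
  have -> : (N - j = (u + m).+1)%N by rewrite /N; lia.
  have -> : (2 * j.+1 + m - j = (m + j.+1).+1)%N by lia.
  by rewrite binS.
have eN : (j.+1 * 'C(N.+1, j.+1) = N.+1 * 'C(N, j))%N by rewrite mul_bin_diag.
have eB : 'C(N.+1, j.+1) = ('C(N, j.+1) + 'C(N, j))%N by rewrite binS.
rewrite [(j.+1 + m)%N]addnC in eK.
set X := 'C(u + m, m + j.+1) in eK eT; set Y := 'C(u + m, _.+1) in eS eT.
(* The recurrence [(m + j + 2) * Y = (u - j - 1) * X], freed of subtraction. *)
have eX : (j.+1 * X + N.+1 * Y = u * (X + Y))%N.
  have [uj|ju] := leqP u j; first by rewrite /X /Y !bin_small ?muln0 //; lia.
  have := mul_bin_left (u + m) (m + j.+1); rewrite -/X -/Y.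
  have -> : (u + m - (m + j.+1) = u - j.+1)%N by lia.
  rewrite mulnBl /N => e.
  have : (j.+1 * X <= u * X)%N by rewrite leq_mul2r ju orbT.
  by move: e; lia.
clearbody X Y N; apply/eqP; rewrite -(@eqn_pmul2l j.+1) //; apply/eqP.
move: eD eT eN eB eK eS eX; rewrite (mulnC 'C(2 * j.+1 + m, j)).
move: 'C(2 * j.+1 + m, j) 'C(N, _) 'C(N, j) 'C(N.+1, _) 'C(N, j.+1) 'C(j + m, m).
move: (kl_sum m.+1 u j.+1) (kl_sum m u j.+1) (kl_sum m.+1 u j) (dissections _ _).
move=> K1 K K' D E B cN B2 B1 c eD eT eN eB eK eS eX.
(* These multipliers make the goal, already scaled by [j.+1], a linear combination of the
   relations. *)
have h1 := congr1 (fun z => cN * j.+1 * z)%N eK.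
have h2 := congr1 (fun z => z * (Y * c))%N eN.
have h3 := congr1 (fun z => u * B * z)%N eD.
have h4 := congr1 (fun z => u * z * c)%N eT.
have h5 := congr1 (fun z => cN * c * z)%N eX.
rewrite eS eB; rewrite eB in h2.
by move: h1 h2 h3 h4 h5 => /=; nia.
Qed.

Lemma uniform_P_coef m u j : (0 < m + j)%N -> (0 < u)%N ->
  u%:R * (uniform_P m (u + j))`_j = ('C(u + j + m, j) * kl_sum m u j)%:R.
Proof.
move=> + u0; elim: m => [|m IHm] in j *.
  case: j => // j _; rewrite /uniform_P addn_gt0 u0 coef1 mulr0.
  by rewrite /kl_sum big_ord0 muln0.
move=> _; elim: j => [|j IH].
  by rewrite uniform_P_coef0 ?addn0 // kl_sum0 bin0 mulr1 mul1n.
rewrite {1}addnS uniform_PS !coefD coefN coefXM coef_step /= -addnS.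
rewrite !mulrDr mulrN IHm ?addnS // IH -[u%:R * _]natrM.
apply/eqP; rewrite addrAC subr_eq -!natrD; have := kl_sum_rec m u j; by rewrite !(addnS, addSn) => ->.
Qed.

Lemma uniform_P_deg m k j : (0 < k)%N -> (k <= 2 * j)%N -> (uniform_P m k)`_j = 0.
Proof.
move=> k0 kj; have [kj'|jk] := leqP k j.
  by rewrite nth_default // (leq_trans (size_uniform_P m k)).
have := @uniform_P_coef m (k - j) j; rewrite kl_sum_small ?muln0; last by lia.
rewrite subnK ?(ltnW jk) // => /(_ _ _)/eqP; rewrite mulf_eq0 pnatr_eq0.
by case/(_ ltac:(lia) ltac:(lia))/orP => [|/eqP//]; lia.
Qed.

(** * Comparison of gamma coefficients *)

Definition gamma_term (k i h : nat) : nat := ('C(k + h, 2 * i + h) * dissections i h)%N.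

Definition gamma_drop (k i : nat) : nat := ('C(k.-1, (2 * i).-1) * dissections i 0)%N.

Lemma gamma_term0 k i : (0 < k)%N -> (0 < i)%N ->
  (2 * i * gamma_term k i 0 = k * gamma_drop k i)%N.
Proof.
case: k i => // k [|i] // _ _; rewrite /gamma_term /gamma_drop !addn0 !mulnA.
by congr (_ * _)%N; rewrite mulnS addSn -mul_bin_diag.
Qed.

(** Expanding into factorials isolates the dependence on [h], so that terms with different [h] can
    be compared. *)
Lemma gamma_term_fact k i h : (2 * i.+1 <= k)%N ->
  (gamma_term k i.+1 h * ((i.+1 + h) * (i.+2 + h)) *
     (i.+1 * (k - 2 * i.+1)`! * (i`! * i`!)) = 'C(k + h, h) * k`!)%N.
Proof.
move=> ik; rewrite /gamma_term.
have eD := @mul_dissections i.+1 h isT; rewrite /= in eD.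
have e1 : ('C(k + h, 2 * i.+1 + h) * ((2 * i.+1 + h)`! * (k - 2 * i.+1)`!) = (k + h)`!)%N.
  by rewrite -(@bin_fact (k + h) (2 * i.+1 + h)) ?leq_add2r // subnDr.
have e2 : ('C(2 * i.+1 + h, i) * (i`! * (i.+2 + h)`!) = (2 * i.+1 + h)`!)%N.
  rewrite -(@bin_fact (2 * i.+1 + h) i); last by lia.
  by congr (_ * (_ * _`!))%N; lia.
have e3 : ('C(i + h, h) * (h`! * i`!) = (i + h)`!)%N.
  by rewrite -(@bin_fact (i + h) h) ?leq_addl // addnK.
have e4 : ('C(k + h, h) * (h`! * k`!) = (k + h)`!)%N.
  by rewrite -(@bin_fact (k + h) h) ?leq_addl // addnK.
have e5 : ((i.+2 + h)`! = (i.+2 + h) * ((i.+1 + h) * (i + h)`!))%N.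
  by rewrite !addSn !factS.
apply/eqP; rewrite -(@eqn_pmul2l (h`! * (i + h)`!)) ?muln_gt0 ?fact_gt0 //; apply/eqP.
transitivity ((k + h)`! * (i + h)`!)%N; last by rewrite -e4; ring.
rewrite -e1 -e2 e5 -{2}e3.
transitivity ('C(k + h, 2 * i.+1 + h) * (i.+1 * dissections i.+1 h) * (h`! * (i + h)`!)
  * ((i.+1 + h) * (i.+2 + h)) * ((k - 2 * i.+1)`! * (i`! * i`!)))%N; first by ring.
rewrite eD; ring.
Qed.

(** Compare [gamma_term_fact] at [h] and at [0]; [gamma_term0] then trades the term at [0] for
    [gamma_drop]. *)
Lemma gamma_termE k i h : (0 < k)%N -> (0 < i)%N ->
  (2 * ((i + h) * (i.+1 + h)) * gamma_term k i h =
   k * i.+1 * 'C(k + h, h) * gamma_drop k i)%N.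
Proof.
move=> k0 i0; have [ki|ik] := ltnP k (2 * i).
  rewrite /gamma_term /gamma_drop !(@bin_small _ (2 * i + h)) ?ltn_add2r //.
  by rewrite (@bin_small k.-1) ?mul0n ?muln0 //; lia.
have e0 := gamma_term0 _ _ k0 i0.
case: i i0 ik e0 => // i _ ik e0.
have e1 := gamma_term_fact _ _ h ik; have e2 := gamma_term_fact _ _ 0 ik.
rewrite bin0 mul1n !addn0 in e2; rewrite -e2 in e1.
set W := (i.+1 * _ * _)%N in e1 e2.
have W0 : (0 < W)%N by rewrite !muln_gt0 !fact_gt0.
apply/eqP; rewrite -(@eqn_pmul2r W) //; apply/eqP.
transitivity (2 * (gamma_term k i.+1 h * ((i.+1 + h) * (i.+2 + h)) * W))%N; first by ring.
rewrite e1; transitivity ('C(k + h, h) * (2 * i.+1 * gamma_term k i.+1 0) * i.+2 * W)%N; first by ring.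
rewrite e0; ring.
Qed.

(** By [gamma_termE] the increment in [gamma_sum_small] reduces to this inequality. It is checked
    with [k] replaced by a lower bound: [m.+1] if [2 * i <= m.+1], and [2 * i] otherwise. *)
Lemma quad_bound_small i k m : (0 < i)%N -> (2 * i <= k)%N -> (m < k)%N ->
  (2 * ((i + m) * (i.+1 + m)) <= i.+1 * (m.+1 * k.+1))%N.
Proof.
case: i => // i _ ik mk; have [h|h] := leqP (2 * i.+1) m.+1.
  have : (i.+2 * (m.+1 * m.+2) <= i.+2 * (m.+1 * k.+1))%N by rewrite !leq_mul.
  have [r rE] : exists r, m = (2 * i + 1 + r)%N by exists (m - (2 * i + 1))%N; lia.
  apply: leq_trans; rewrite rE; case: i {ik h rE} => [|i]; nia.
have : (i.+2 * (m.+1 * (2 * i.+1).+1) <= i.+2 * (m.+1 * k.+1))%N by rewrite !leq_mul.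
have [r rE] : exists r, (2 * i = m + r)%N by exists (2 * i - m)%N; lia.
have := congr1 (muln m) rE; have : (i * m <= i * i * m)%N by case: (i) => // n; nia.
by move=> h1 h2; apply: leq_trans; nia.
Qed.

(** The same reduction for [gamma_sum_large]; it follows from [quad_bound_small] at [k = m.+1]. *)
Lemma quad_bound_large i k m : (0 < i)%N -> (2 * i <= k)%N -> (k <= m)%N ->
  (2 * (k.-1 * ((i + m) * (i.+1 + m))) <= k * (i.+1 * (m.+1 * m.+2)))%N.
Proof.
move=> i0 ik km; have : (2 * i <= m.+1)%N by lia.
move=> im; have := @quad_bound_small i m.+1 m i0 im (leqnn _).
by move=> h; rewrite mulnCA; apply: leq_mul (leq_pred _) h.
Qed.

Lemma gamma_sum_small k i m : (0 < i)%N -> (2 * i <= k)%N -> (m < k)%N ->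
  ('C(k + m.+1, m.+1) * gamma_drop k i <= k.+1 * \sum_(h < m.+1) gamma_term k i h)%N.
Proof.
move=> i0 ik; have k0 : (0 < k)%N by lia.
elim: m => [|m IH] mk.
  rewrite addn1 bin1 big_ord1 leq_mul2l /= -(@leq_pmul2l (2 * i)) ?muln_gt0 //.
  by rewrite gamma_term0 // leq_mul2r ik orbT.
rewrite big_ord_recr /= mulnDr addnS binS mulnDl [leqLHS]addnC.
apply: leq_add; first exact/IH/ltnW.
have e := gamma_termE k i m.+1 k0 i0.
have q := quad_bound_small i k m.+1 i0 ik mk.
have b : (m.+2 * 'C(k + m.+1, m.+2) = k * 'C(k + m.+1, m.+1))%N.
  by rewrite mul_bin_left addnK mulnC.
set W := ((i + m.+1) * (i.+1 + m.+1))%N in e q.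
have W0 : (0 < 2 * W)%N by rewrite !muln_gt0 addn_gt0 i0.
rewrite -(@leq_pmul2l (2 * W * m.+2)) ?(muln_gt0 _ m.+2) ?W0 //.
apply: (@leq_trans (i.+1 * (m.+2 * k.+1) * (k * 'C(k + m.+1, m.+1) * gamma_drop k i))).
  rewrite -b; apply: leq_trans (leq_mul q (leqnn _)); apply: eq_leq; ring.
apply: eq_leq; transitivity (m.+2 * k.+1 * (k * i.+1 * 'C(k + m.+1, m.+1) * gamma_drop k i))%N; first by ring.
by rewrite -e; ring.
Qed.

Lemma gamma_sum_large k i m : (0 < i)%N -> (2 * i <= k)%N -> (k <= m)%N ->
  ('C(k + m, m) * gamma_drop k i <= m.+1 * \sum_(h < m) gamma_term k i h)%N.
Proof.
move=> i0 ik km; have k0 : (0 < k)%N by lia.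
rewrite -(subnKC km); elim: (m - k)%N => {km} [|r].
  (* At [m = k] the factors [k.+1] and [m.+1] agree, so [gamma_sum_small] starts the induction. *)
  rewrite addn0; case: k k0 ik => // k k0 ik.
  exact: gamma_sum_small.
rewrite addnS; set n := (k + r)%N => IH.
have kn : (k <= n)%N by rewrite leq_addr.
rewrite big_ord_recr /= mulnDr.
have e := gamma_termE k i n k0 i0; have q := quad_bound_large i k n i0 ik kn.
set T := gamma_term k i n in e *; set G := (\sum_(_ < _) _)%N in IH *.
(* The summand with [n.+2] is left to the induction hypothesis, the one with [k.-1] to the new term
   [T]. *)
have b : (n.+1 * 'C(k + n.+1, n.+1) = k.-1 * 'C(k + n, n) + n.+2 * 'C(k + n, n))%N.
  by rewrite addnS -mul_bin_diag -mulnDl; congr (_ * _)%N; lia.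
set W := ((i + n) * (i.+1 + n))%N in e q.
have W0 : (0 < 2 * W)%N by rewrite !muln_gt0 addn_gt0 i0.
have h : (k.-1 * ('C(k + n, n) * gamma_drop k i) <= n.+1 * n.+2 * T)%N.
  rewrite -(@leq_pmul2l (2 * W)) //.
  apply: (@leq_trans (k * (i.+1 * (n.+1 * n.+2)) * ('C(k + n, n) * gamma_drop k i))).
    by apply: leq_trans (leq_mul q (leqnn _)); apply: eq_leq; ring.
  apply: eq_leq; transitivity (n.+1 * n.+2 * (k * i.+1 * 'C(k + n, n) * gamma_drop k i))%N; first by ring.
  by rewrite -e; ring.
rewrite -(@leq_pmul2l n.+1) // mulnA b mulnDl mulnDr [leqLHS]addnC.
apply: leq_add; first by rewrite -mulnA [leqRHS]mulnCA leq_mul2l IH orbT.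
by rewrite -mulnA (leq_trans h) // mulnA.
Qed.

Lemma gamma_drop_le lam k i m : (0 < m)%N -> (0 < i)%N ->
  (k.+1 * lam <= 'C(k + m, m))%N -> (m.+1 * lam <= 'C(k + m, m))%N ->
  (lam * gamma_drop k i <= \sum_(h < m) gamma_term k i h)%N.
Proof.
move=> m0 i0 lk lm; have [ki|ik] := ltnP k (2 * i).
  by rewrite /gamma_drop (@bin_small k.-1) ?mul0n ?muln0 //; lia.
have [mk|km] := leqP m k.
  rewrite -(@leq_pmul2l k.+1) // mulnA (leq_trans (leq_mul lk (leqnn _))) //.
  by case: m m0 mk {lk lm} => // m _ mk; apply: gamma_sum_small.
rewrite -(@leq_pmul2l m.+1) // mulnA (leq_trans (leq_mul lm (leqnn _))) //.
by apply: gamma_sum_large => //; apply: ltnW.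
Qed.

(** The changes of [P] and [Z] under the relaxation of a circuit-hyperplane do not
    depend on [m]; for [m = 1] the matroid with one circuit-hyperplane is the sum of
    a uniform matroid of rank [k - 1] on [k] elements and a coloop. *)
Definition relax_P (k : nat) : {poly int} := uniform_P 1 k - uniform_P 1 k.-1.

Definition relax_Z (k : nat) : {poly int} :=
  \sum_(i < k./2.+1) (gamma_drop k i)%:R *: ('X^i * (1 + 'X) ^+ (k - 2 * i)).

Lemma relax_P_deg k j : (0 < k)%N -> (k <= 2 * j)%N -> (relax_P k)`_j = 0.
Proof.
case: k => // k _ kj; rewrite /relax_P coefB uniform_P_deg //.
by case: k kj => [|k] kj; rewrite ?uniform_P0 ?coef0 ?uniform_P_deg ?subrr // ltnW.
Qed.

(** A coloop multiplies [Z] by [1 + 'X]; on gamma coefficients the identity is Pascal's rule. *)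
Lemma relax_ZE k : relax_Z k.+1 = uniform_Z 1 k.+1 - (1 + 'X) * uniform_Z 1 k.
Proof.
have -> : (1 + 'X) * uniform_Z 1 k = \sum_(i < k.+1./2.+1)
    (uniform_gamma 1 k i)%:R *: ('X^i * (1 + 'X) ^+ (k.+1 - 2 * i)).
  rewrite /uniform_Z big_distrr /=.
  have e (i : 'I_k./2.+1) : (1 + 'X : {poly int}) * ((uniform_gamma 1 k i)%:R *: ('X^i * (1 + 'X) ^+ (k - 2 * i)))
      = (uniform_gamma 1 k i)%:R *: ('X^i * (1 + 'X) ^+ (k.+1 - 2 * i)).
    have ik : (2 * i <= k)%N by have := ltn_ord i; lia.
    by rewrite subSn // exprS -scalerAr mulrCA.
  rewrite (eq_bigr _ (fun i _ => e i)).
  (* For odd [k] the longer range has one more index, with [2 * i = k.+1] and coefficient [0]. *)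
  rewrite uphalf_half; case: (boolP (odd k)) => [ok|_]; last by [].
  rewrite add1n [RHS]big_ord_recr /= [X in _ = _ + X](_ : _ = 0) ?addr0 //.
  by rewrite /uniform_gamma big_ord1 bin_small ?mul0n ?scale0r //=; lia.
rewrite /uniform_Z -sumrB; apply: eq_bigr => i _; rewrite -scalerBl; congr (_ *: _).
rewrite /uniform_gamma /gamma_drop !big_ord1 !addn0 /=.
case: (nat_of_ord i) => [|j]; first by rewrite dissections0 !muln0 subrr.
rewrite !add0n mulnS add2n /= binS mulnDl natrD.
by rewrite addrC addKr.
Qed.

(** Relaxing a circuit-hyperplane loses that flat, of weight ['X^(k.-1)], and changes [P] by
    [relax_P (k - i)] at each of its proper subsets with [i] elements. *)
Lemma relax_Z_rec k : (0 < k)%N -> relax_Z k + 'X^(k.-1) =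
  \sum_(i < k) 'C(k, i)%:R *: ('X^i * relax_P (k - i)).
Proof.
case: k => // k _; rewrite relax_ZE !uniform_Z_rec /=.
set B := (\sum_(i < k) _).
have -> : \sum_(i < k.+1) 'C(k.+1 + 1, i)%:R *: ('X^i * uniform_P 1 (k.+1 - i)) =
  \sum_(i < k.+1) 'C(k.+1, i)%:R *: ('X^i * uniform_P 1 (k.+1 - i)) + 'X * B.
  rewrite big_ord_recl [in RHS]big_ord_recl /= !bin0 -addrA; congr (_ + _).
  rewrite /B big_distrr -big_split; apply: eq_bigr => i _ /=.
  rewrite /bump /= add1n subSS !addn1 binS natrD scalerDl; congr (_ + _).
  by rewrite -scalerAr mulrA -exprS.
have -> : \sum_(i < k.+1) 'C(k.+1, i)%:R *: ('X^i * relax_P (k.+1 - i)) =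
   \sum_(i < k.+1) 'C(k.+1, i)%:R *: ('X^i * uniform_P 1 (k.+1 - i)) - B.
  have -> : B = \sum_(i < k.+1) 'C(k.+1, i)%:R *: ('X^i * uniform_P 1 (k - i)).
    by rewrite big_ord_recr /= subnn uniform_P0 mulr0 scaler0 addr0 /B addn1.
  rewrite -sumrB; apply: eq_bigr => i _; rewrite -scalerBr -mulrBr /relax_P.
  by rewrite subSn // -ltnS.
by rewrite exprS; ring.
Qed.

(** This determines [P] from lower ranks: the difference of two candidates has degree below [d / 2]
    and equals a difference of palindromic polynomials. *)
Lemma palindromic_small_eq0 d (p : {poly int}) :
  (forall j, (d <= 2 * j)%N -> p`_j = 0) -> rev_poly d p = p -> p = 0.
Proof.
move=> h e; apply/polyP => j; rewrite coef0; have [/h//|jd] := leqP d (2 * j).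
by rewrite -e coef_rev; case: ifP => // jd'; apply: h; lia.
Qed.

(** * Sparse paving matroids *)

Section SparsePaving.

Variable T : finType.
Implicit Types (M : matroid T) (A B F S : {set T}) (P : matroid T -> {poly int}).

Lemma sum_card_lt S k (f : nat -> {poly int}) :
  \sum_(F : {set T} | (F \subset S) && (#|F| < k)%N) f #|F| =
  \sum_(i < k) 'C(#|S|, i)%:R *: f i.
Proof.
transitivity (\sum_(i < k) \sum_(F : {set T} | (F \subset S) && (#|F| == i)) f i).
  rewrite (exchange_big_dep (fun F : {set T} => (F \subset S) && (#|F| < k)%N)) /=.
    apply: eq_bigr => F /andP[sF Fk].
    by rewrite (big_pred1 (Ordinal Fk)) // => i; rewrite sF /= eq_sym.
  by move=> i F _ /andP[-> /eqP->]; rewrite ltn_ord.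
apply: eq_bigr => i _; rewrite -cards_draws scaler_nat -sumr_const.
by apply: eq_bigl => F; rewrite inE.
Qed.

Lemma mul_card_le (H D : {set {set T}}) (R : rel {set T}) c :
  (forall A, A \in H -> c <= #|[set B in D | R A B]|)%N ->
  (forall A A' B, A \in H -> A' \in H -> R A B -> R A' B -> A = A') ->
  (c * #|H| <= #|D|)%N.
Proof.
move=> hc hR; rewrite mulnC -sum_nat_const -[leqRHS]sum1_card.
apply: (@leq_trans (\sum_(A in H) \sum_(B in D | R A B) 1)%N).
  by apply: leq_sum => A /hc; rewrite -sum1_card; congr (_ <= _)%N; apply: eq_bigl => B; rewrite inE.
rewrite (exchange_big_dep (fun B => B \in D)) /=; last by move=> ? ? _ /andP[].
apply: leq_sum => B BD; rewrite sum1dep_card.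
apply/card_le1_eqP => A A'; rewrite !inE BD /= => /andP[HA RA] /andP[HA' RA'].
by apply: (hR _ _ B).
Qed.

(** A loop annihilates every characteristic polynomial in the recursion. Sums over flats can thus be
    extended to all small subsets. *)
Lemma KL_loop P M : KL_assignment P -> (0 < rank M)%N -> ~~ flat M set0 -> P M = 0.
Proof.
move=> hP rM nf0; have [_ _ e] := hP M.
rewrite -(rev_polyK (KL_size M hP)) e big1 ?rev_poly0 // => F; rewrite inE => fF.
by have [sF _] := flatP _ _ fF; rewrite chi_loc // flat0 // mul0r.
Qed.

Lemma KL_contraction_ground P M : KL_assignment P -> P (contraction M (ground M)) = 1.
Proof.
move=> hP; have [h _ _] := hP (contraction M (ground M)).
by rewrite h /= ?setDv ?eqxx // rank_con // subnn.
Qed.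

Lemma KL_deg P M j : KL_assignment P -> (0 < rank M)%N -> (rank M <= 2 * j)%N ->
  (P M)`_j = 0.
Proof.
move=> hP rM rj; have [_ /(_ rM) h _] := hP M; apply: nth_default.
by move: h; case: (size _) => [|s] /=; lia.
Qed.

(** The two flats give [Z = P M + 'X], palindromic of degree one like [1 + 'X], so
    [palindromic_small_eq0] applies to [P M - 1]. *)
Lemma KL_rank1 P M : KL_assignment P -> rank M = 1%N -> flat M set0 -> P M = 1.
Proof.
move=> hP r1 f0; apply/eqP; rewrite -subr_eq0; apply/eqP.
have [sE hE] := flatP _ _ f0.
have fE : flats M = [set set0; ground M].
  apply/setP => F; rewrite !inE; apply/idP/orP => [/flatP[sF hF]|[] /eqP->//]; last exact: flatE.
  have [->|[x xF]] := set_0Vmem F; [by left | right].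
  rewrite eqEsubset sF; apply/subsetP => y yE; apply: contraT => yF.
  have := hF y yE yF; have := hE x (subsetP sF x xF); rewrite inE => /(_ isT).
  rewrite setU0 rk0; have : (rk M [set x] <= rk M F)%N by rewrite rk_mono ?sub1set.
  have : (rk M (y |: F) <= rank M)%N by rewrite rk_mono // subUset sub1set yE.
  by rewrite r1; lia.
have n0 : set0 != ground M.
  by apply: contraTneq (leqnn (rank M)) => e; rewrite {2}/rank -e rk0 r1.
have pal := Z_palindromic M hP; rewrite /Z_poly fE big_setU1 ?inE //= big_set1 in pal.
rewrite con0 rk0 mul1r KL_contraction_ground // mulr1 -/(rank M) r1 in pal.
apply: (@palindromic_small_eq0 1) => [j j1|].
  by rewrite coefB coef1 KL_deg ?r1 //; case: j j1.
have c1 : rev_poly 1 (1 + 'X) = 1 + 'X by have := rev_1X 1.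
have -> : P M - 1 = (P M + 'X^1) + (-1) *: (1 + 'X) by rewrite scaleN1r; ring.
by rewrite rev_polyD rev_polyZ pal c1.
Qed.

(** * Rank function, circuit-hyperplanes and flats *)

Definition sparse M := forall A, A \subset ground M ->
  ((#|A| < rank M)%N -> rk M A = #|A|) /\ ((rank M < #|A|)%N -> rk M A = rank M).

Lemma rank_dual M : rank (dual M) = (#|ground M| - rank M)%N.
Proof. by rewrite /rank rk_dual /= setIid setDv rk0 addn0. Qed.

Lemma paving_rk M A : paving M -> A \subset ground M -> (#|A| < rank M)%N ->
  rk M A = #|A|.
Proof.
move=> pM sA Ak; apply/eqP; apply: contraT => dA.
have [C cC sCA] : {C | minset (fun A => (A \subset ground M) && ~~ indep M A) C & C \subset A}.
  by apply: minset_exists; rewrite sA /indep sA.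
have := leq_trans (pM C cC) (subset_leq_card sCA); lia.
Qed.

(** The complement of a set larger than the rank is small enough to be independent in the dual, so
    the set spans [M]. *)
Lemma sparse_paving_sparse M : sparse_paving M -> sparse M.
Proof.
move=> [pM pM'] A sA; split=> [|kA]; first exact: paving_rk.
have sB : ground M :\: A \subset ground M by apply: subsetDl.
have cA : (#|ground M| = #|A| + #|ground M :\: A|)%N.
  by rewrite -(cardsID A (ground M)) (setIidPr sA).
have := @paving_rk (dual M) (ground M :\: A) pM' sB; rewrite rank_dual => /(_ ltac:(lia)).
rewrite rk_dual (setIidPl sB) setDDr setDv set0U (setIidPr sA).
have := dual_rk_ge M (ground M :\: A); rewrite (setIidPl sB) setDDr setDv set0U (setIidPr sA).
lia.
Qed.

(** When [M] is sparse, smaller sets are independent, so these sets are circuits; [rk_ch] and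
    [flat_ch] make them hyperplanes. *)
Definition circuit_hyperplanes M : {set {set T}} :=
  [set A : {set T} | [&& A \subset ground M, #|A| == rank M & (rk M A < rank M)%N]].

Lemma rank_le_card M : (rank M <= #|ground M|)%N.
Proof. by have := rk_le M (ground M); rewrite setIid. Qed.

Lemma sparse_contraction M F : sparse M -> F \subset ground M -> (#|F| < rank M)%N ->
  sparse (contraction M F).
Proof.
move=> sM sF Fk A; rewrite subsetD => /andP[sA dAF].
have cU : #|A :|: F| = (#|A| + #|F|)%N.
  by rewrite cardsU disjoint_setI0 // cards0 subn0.
have [h1 h2] : _ /\ _ := sM (A :|: F) ltac:(by rewrite subUset sA).
have [hF _] := sM F sF.
rewrite rank_con // rk_con hF //; rewrite cU in h1 h2.
by split=> hA; [rewrite h1|rewrite h2]; lia.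
Qed.

Lemma card_ch_contraction M F : sparse M -> F \subset ground M -> (#|F| < rank M)%N ->
  #|circuit_hyperplanes (contraction M F)| =
  #|[set A in circuit_hyperplanes M | F \subset A]|.
Proof.
move=> sM sF Fk; have [/(_ Fk) hF _] := sM F sF.
rewrite -(@card_in_imset _ _ (fun A => A :|: F)) => [|A B]; last first.
  rewrite !inE !subsetD => /andP[/andP[_ dA] _] /andP[/andP[_ dB] _] /(congr1 (fun S => S :\: F)).
  by rewrite !setDUl !setDv !setU0 !(setDidPl _).
apply: eq_card => A; apply/imsetP/idP => [[B + ->]|].
  rewrite !inE rank_con // rk_con hF subsetD => /and3P[/andP[sB dB] /eqP cB rB].
  rewrite subUset sB sF subsetUr cardsU disjoint_setI0 // cards0 subn0 cB /= andbT.
  by apply/andP; split; lia.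
rewrite inE => /andP[]; rewrite inE => /and3P[sA /eqP cA rA] sFA.
have e : A = A :\: F :|: F by rewrite setUC -{1}(setIidPr sFA) setID.
exists (A :\: F) => //; rewrite inE rank_con // rk_con -e hF /= setSD //.
by rewrite cardsD (setIidPr sFA) cA eqxx /=; lia.
Qed.

Lemma rk_ch M A : sparse M -> (0 < rank M)%N -> A \in circuit_hyperplanes M ->
  rk M A = (rank M).-1.
Proof.
move=> sM k0; rewrite inE => /and3P[sA /eqP cA rA].
have [A0|[x xA]] := set_0Vmem A; first by rewrite -cA A0 cards0 in k0.
have cx := cardsD1 x A; rewrite xA in cx.
have sx : A :\ x \subset A by apply: subsetDl.
have [h _] := sM (A :\ x) (subset_trans sx sA).
have := rk_mono M sx; rewrite h; lia.
Qed.

Lemma flat_ch M A : sparse M -> A \in circuit_hyperplanes M -> flat M A.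
Proof.
move=> sM; rewrite inE => /and3P[sA /eqP cA rA]; apply/flatP; split=> // x xE xA.
have [|_ h] := sM (x |: A); first by rewrite subUset sub1set xE.
by rewrite h // cardsU1 xA cA.
Qed.

Lemma large_flats M : sparse M ->
  [set F in flats M | (rank M <= #|F|)%N] = ground M |: circuit_hyperplanes M.
Proof.
move=> sM; apply/setP => F; rewrite inE in_setU1 [F \in flats M]inE.
apply/andP/orP => [[fF kF]|[/eqP->|hF]]; last 2 first.
- by rewrite flatE rank_le_card.
- by rewrite (flat_ch _ _ sM hF); move: hF; rewrite inE => /and3P[_ /eqP-> _].
have [sF hF] := flatP _ _ fF.
have [sEF|/subsetPn[x xE xF]] := boolP (ground M \subset F).
  by left; rewrite eqEsubset sF.
right; rewrite inE sF eqn_leq kF.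
have := hF x xE xF; have : (rk M (x |: F) <= rank M)%N by rewrite rk_mono // subUset sub1set xE.
have [_ h] := sM F sF; case: ltngtP kF => //=; lia.
Qed.

(** Circuit-hyperplanes have loopless contractions of rank one, with [P = 1]; small sets that are
    not flats contribute zero by [KL_loop]. *)
Lemma Z_sparse P M : KL_assignment P -> sparse M -> (0 < rank M)%N ->
  Z_poly P M = 'X^(rank M) + #|circuit_hyperplanes M|%:R *: 'X^((rank M).-1) +
    \sum_(F : {set T} | (F \subset ground M) && (#|F| < rank M)%N)
       'X^#|F| * P (contraction M F).
Proof.
move=> hP sM k0; rewrite /Z_poly (bigID (fun F => rank M <= #|F|)%N) /=; congr (_ + _).
  rewrite (eq_bigl (fun F => F \in ground M |: circuit_hyperplanes M)); last first.
    by move=> F; rewrite -(large_flats _ sM) [RHS]inE.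
  rewrite big_setU1 /=; last by rewrite inE ltnn !andbF.
  rewrite KL_contraction_ground // mulr1 -/(rank M); congr (_ + _).
  rewrite scaler_nat -sumr_const; apply: eq_bigr => A hA.
  rewrite rk_ch // KL_rank1 ?mulr1 //.
    rewrite rank_con; first by rewrite rk_ch //; lia.
    by move: hA; rewrite inE => /and3P[].
  rewrite flat_contraction; last by move: hA; rewrite inE => /and3P[].
  by rewrite -setI_eq0 set0I eqxx set0U flat_ch.
rewrite [RHS](bigID (flat M)) /= [X in _ = _ + X]big1 ?addr0; last first.
  move=> F /andP[/andP[sF Fk] nF]; rewrite KL_loop ?mulr0 //.
    by have [/(_ Fk) h _] := sM F sF; rewrite rank_con // h; lia.
  by rewrite flat_contraction // -setI_eq0 set0I eqxx set0U.
apply: eq_big => [F|F /andP[]]; rewrite inE -ltnNge.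
  case: (boolP (flat M F)) => fF; rewrite ?andbF //.
  by have [-> _] := flatP _ _ fF; rewrite andbT.
by move=> /flatP[sF _] Fk; have [/(_ Fk)-> _] := sM F sF.
Qed.

(** * Closed forms of the two polynomials and the induction on the rank *)

Definition corank M : nat := (#|ground M| - rank M)%N.

Definition sparse_P M : {poly int} :=
  uniform_P (corank M) (rank M) - #|circuit_hyperplanes M|%:R *: relax_P (rank M).

Definition sparse_Z M : {poly int} :=
  uniform_Z (corank M) (rank M) - #|circuit_hyperplanes M|%:R *: relax_Z (rank M).

Definition sparse_gamma M (i : nat) : int :=
  (uniform_gamma (corank M) (rank M) i)%:R -
  (#|circuit_hyperplanes M| * gamma_drop (rank M) i)%:R.

Lemma sparse_ZE M : sparse_Z M = \sum_(i < (rank M)./2.+1)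
  sparse_gamma M i *: ('X^i * (1 + 'X) ^+ (rank M - 2 * i)).
Proof.
rewrite /sparse_Z /uniform_Z /relax_Z scaler_sumr -sumrB; apply: eq_bigr => i _.
by rewrite scalerA -natrM -scalerBl.
Qed.

Lemma sparse_Z_palindromic M : rev_poly (rank M) (sparse_Z M) = sparse_Z M.
Proof.
rewrite sparse_ZE rev_poly_sum; apply: eq_bigr => i _; rewrite rev_polyZ; congr (_ *: _).
have hi : (2 * i <= rank M)%N by have := ltn_ord i; lia.
have {1}-> : rank M = ((i + i) + (rank M - 2 * i))%N by lia.
rewrite rev_polyM ?size_1X ?size_polyXn ?rev_1X //; last by lia.
by rewrite rev_polyXn ?leq_addr // addnK.
Qed.

Lemma sparse_P_contraction M F : sparse M -> F \subset ground M -> (#|F| < rank M)%N ->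
  sparse_P (contraction M F) = uniform_P (corank M) (rank M - #|F|) -
    #|[set A in circuit_hyperplanes M | F \subset A]|%:R *: relax_P (rank M - #|F|).
Proof.
move=> sM sF Fk; have [/(_ Fk) rF _] := sM F sF.
rewrite /sparse_P card_ch_contraction // rank_con // rF; congr (uniform_P _ _ - _).
rewrite /corank rank_con // rF /= cardsD (setIidPr sF).
have := subset_leq_card sF; have := rank_le_card M; lia.
Qed.

(** Exchanging the sums over [F] and over the circuit-hyperplanes containing [F] gives one copy of
    [relax_Z_rec] per circuit-hyperplane, next to [uniform_Z_rec]. *)
Lemma sparse_Z_rec M : sparse M -> (0 < rank M)%N ->
  sparse_Z M = 'X^(rank M) + #|circuit_hyperplanes M|%:R *: 'X^((rank M).-1) +
    \sum_(F : {set T} | (F \subset ground M) && (#|F| < rank M)%N)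
       'X^#|F| * sparse_P (contraction M F).
Proof.
move=> sM k0; set k := rank M; set H := circuit_hyperplanes M.
transitivity ('X^k + #|H|%:R *: 'X^(k.-1) +
   (\sum_(F : {set T} | (F \subset ground M) && (#|F| < k)%N)
      'X^#|F| * uniform_P (corank M) (k - #|F|)
    - \sum_(A in H) \sum_(F : {set T} | (F \subset A) && (#|F| < k)%N)
      'X^#|F| * relax_P (k - #|F|))); last first.
  congr (_ + _).
  rewrite (exchange_big_dep (fun F : {set T} => (F \subset ground M) && (#|F| < k)%N)) /=; last first.
    by move=> A F; rewrite inE => /and3P[sA _ _] /andP[sFA ->]; rewrite (subset_trans sFA).
  rewrite -sumrB; apply: eq_bigr => F /andP[sF Fk]; rewrite sparse_P_contraction //.
  rewrite (eq_bigl (fun A => A \in [set A in H | F \subset A])); last first.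
    by move=> A; rewrite [RHS]inE Fk andbT.
  by rewrite sumr_const -scaler_nat [RHS]mulrBr -[in RHS]scalerAr.
rewrite (sum_card_lt _ _ (fun i => 'X^i * uniform_P (corank M) (k - i))).
have -> : \sum_(A in H) \sum_(F : {set T} | (F \subset A) && (#|F| < k)%N)
      'X^#|F| * relax_P (k - #|F|) = #|H|%:R *: (relax_Z k + 'X^(k.-1)).
  rewrite relax_Z_rec // scaler_nat -sumr_const; apply: eq_bigr => A.
  rewrite inE => /and3P[_ /eqP cA _].
  by rewrite (sum_card_lt _ _ (fun i => 'X^i * relax_P (k - i))) cA.
rewrite /sparse_Z uniform_Z_rec -/k -/H.
have -> : #|ground M| = (k + corank M)%N by rewrite subnKC // rank_le_card.
rewrite scalerDr; move: (\sum_(i < k) _) (_ *: relax_Z k) (_ *: 'X^(k.-1)) ('X^k).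
by move=> S R X0 X1; ring.
Qed.

Lemma KL_sparse P M : KL_assignment P -> sparse M -> (0 < rank M)%N ->
  P M = sparse_P M /\ Z_poly P M = sparse_Z M.
Proof.
move=> hP; have [n] := ubnP (rank M); elim: n M => // n IH M /ltnSE kn sM k0.
(* By induction the terms with nonempty [F] agree in [Z_sparse] and [sparse_Z_rec]; only the term of
   [set0] survives. *)
have e : Z_poly P M - sparse_Z M = P M - sparse_P M.
  rewrite Z_sparse // sparse_Z_rec // opprD addrACA subrr add0r -sumrB.
  rewrite (bigD1 set0) /=; last by rewrite sub0set cards0.
  rewrite cards0 !mul1r con0 big1 ?addr0 // => F /andP[/andP[sF Fk] F0].
  have [/(_ Fk) rF _] := sM F sF.
  have [] := IH (contraction M F); rewrite ?rank_con ?rF //; last by move=> ->; rewrite subrr.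
  - by have : (0 < #|F|)%N; [rewrite card_gt0 | lia].
  - exact: sparse_contraction.
  - by rewrite subn_gt0.
suff z : P M - sparse_P M = 0.
  by split; apply/eqP; rewrite -subr_eq0 ?e z.
apply: (palindromic_small_eq0 (rank M)) => [j kj|].
  by rewrite !coefB coefZ KL_deg // uniform_P_deg // relax_P_deg // mulr0 !subr0.
by rewrite -e -scaleN1r rev_polyD rev_polyZ Z_palindromic // sparse_Z_palindromic.
Qed.

(** * Bounds on the number of circuit-hyperplanes *)

Lemma ch_inter M A B : sparse M -> A \in circuit_hyperplanes M ->
  B \in circuit_hyperplanes M -> ((rank M).-1 <= #|A :&: B|)%N -> A = B.
Proof.
move=> sM hA hB hAB; have [k0|k0] := posnP (rank M).
  move: hA hB; rewrite !inE k0 => /and3P[_ /eqP/cards0_eq-> _].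
  by move=> /and3P[_ /eqP/cards0_eq-> _].
have eA := rk_ch _ _ sM k0 hA; have eB := rk_ch _ _ sM k0 hB.
move: hA hB; rewrite !inE => /and3P[sA /eqP cA _] /and3P[sB /eqP cB _].
have cI := cardsUI A B; rewrite cA cB in cI.
have sI : A :&: B \subset ground M by rewrite subIset ?sA.
have sU : A :|: B \subset ground M by rewrite subUset sA.
have [h1 _] := sM _ sI; have [_ h2] := sM _ sU.
have sub := rk_submod M A B; rewrite eA eB in sub.
have [kI|Ik] := leqP (rank M) #|A :&: B|.
  have /eqP eIA : A :&: B == A by rewrite eqEcard subsetIl cA.
  have /eqP eIB : A :&: B == B by rewrite eqEcard subsetIr cB.
  by rewrite -eIA {1}eIB.
(* With [k] the rank, the intersection has [k - 1] elements and is independent, while the union has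
   [k + 1] and spans; submodularity would give [2 * k - 1 <= 2 * k - 2]. *)
rewrite h1 // h2 in sub; lia.
Qed.

(** Each circuit-hyperplane has [rank M] subsets with one element less, and by [ch_inter] no two
    share such a subset. *)
Lemma ch_le_sub M : sparse M -> (0 < rank M)%N ->
  (rank M * #|circuit_hyperplanes M| <= 'C(#|ground M|, (rank M).-1))%N.
Proof.
move=> sM k0; rewrite -cards_draws.
apply: (mul_card_le _ _ (fun A B => (B \subset A) && (#|B| == (rank M).-1))).
  move=> A; rewrite inE => /and3P[sA /eqP cA _].
  apply: (@leq_trans 'C(#|A|, (rank M).-1)).
    by rewrite cA; case: (rank M) k0 => // r _; rewrite binSn.
  rewrite -cards_draws subset_leq_card //; apply/subsetP => B; rewrite !inE.
  by move=> /andP[sBA cB]; rewrite sBA (subset_trans sBA sA) cB.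
move=> A A' B hA hA' /andP[sBA /eqP cB] /andP[sBA' _].
by apply: (ch_inter M) => //; rewrite -cB subset_leq_card // subsetI sBA.
Qed.

(** Each circuit-hyperplane has [corank M] extensions by one element; two with a common extension
    would meet in at least [(rank M).-1] elements. *)
Lemma ch_le_super M : sparse M ->
  (corank M * #|circuit_hyperplanes M| <= 'C(#|ground M|, (rank M).+1))%N.
Proof.
move=> sM; rewrite -cards_draws.
apply: (mul_card_le _ _ (fun A B => (A \subset B) && (#|B| == (rank M).+1))).
  move=> A; rewrite inE => /and3P[sA /eqP cA _].
  have -> : corank M = #|[set x |: A | x in ground M :\: A]|.
    rewrite card_in_imset => [|x y].
      by rewrite cardsD (setIidPr sA) cA.
    rewrite !inE => /andP[xA _] /andP[yA _] /setP/(_ x).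
    by rewrite !inE eqxx (negbTE xA) !orbF => /esym/eqP.
  apply: subset_leq_card; apply/subsetP => _ /imsetP[x + ->].
  rewrite !inE => /andP[xA xE]; rewrite subsetUr cardsU1 xA cA eqxx.
  by rewrite subUset sub1set xE sA.
move=> A A' B hA hA' /andP[sAB /eqP cB] /andP[sAB' _].
apply: (ch_inter M) => //; have cI := cardsUI A A'.
have : (#|A :|: A'| <= #|B|)%N by rewrite subset_leq_card // subUset sAB.
move: hA hA'; rewrite !inE cB => /and3P[_ /eqP cA _] /and3P[_ /eqP cA' _].
by rewrite cA cA' in cI; lia.
Qed.

Lemma sparse_gamma_ge0 M i : sparse M -> (0 < rank M)%N -> 0 <= sparse_gamma M i.
Proof.
move=> sM k0; rewrite /sparse_gamma subr_ge0 ler_nat.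
case: i => [|i]; first by rewrite /gamma_drop dissections0 !muln0.
apply: leq_trans (leq_addl _ _).
have cE : #|ground M| = (rank M + corank M)%N by rewrite subnKC // rank_le_card.
(* In corank zero only the ground set has [rank M] elements, and it has full rank, so there are no
   circuit-hyperplanes. *)
have [m0|m0] := posnP (corank M).
  rewrite m0 big_ord0 leqn0 muln_eq0 cards_eq0; apply/orP; left.
  rewrite -subset0; apply/subsetP => A; rewrite inE => /and3P[sA /eqP cA].
  have /eqP-> : A == ground M by rewrite eqEcard sA cA cE m0 addn0 leqnn.
  by rewrite -/(rank M) ltnn.
have h1 := ch_le_sub M sM k0; have h2 := ch_le_super M sM.
have cC : 'C(rank M + corank M, corank M) = 'C(#|ground M|, rank M).
  by rewrite cE -bin_sub ?leq_addl // addnK.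
apply: gamma_drop_le => //; rewrite cC.
  (* Scaling by [corank M] moves the binomial to the index [(rank M).+1] of [ch_le_super]. *)
  rewrite -(@leq_pmul2l (corank M)) // mulnCA.
  have -> : (corank M * 'C(#|ground M|, rank M) =
             (rank M).+1 * 'C(#|ground M|, (rank M).+1))%N.
    by rewrite mul_bin_left cE addKn.
  by rewrite leq_mul2l h2 orbT.
rewrite -(@leq_pmul2l (rank M)) // mulnCA.
have -> : (rank M * 'C(#|ground M|, rank M) =
           (corank M).+1 * 'C(#|ground M|, (rank M).-1))%N.
  rewrite -{1 2}(prednK k0) mul_bin_left cE; congr (_ * _)%N; lia.
by rewrite leq_mul2l h1 orbT.
Qed.

End SparsePaving.

Theorem theorem5p16 (T : finType) (M : matroid T) (hM : sparse_paving M)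
    (P : matroid T -> {poly int}) (hP : KL_assignment P)
    (g : {poly int}) (hg : is_gamma_poly (rank M) (Z_poly P M) g) :
  forall i : nat, 0 <= g`_i.
Proof.
move=> i; have sM := sparse_paving_sparse T M hM.
have [k0|k0] := posnP (rank M).
  (* In rank zero, which [KL_sparse] excludes, [Z = 1] and hence [g = 1]. *)
  have [sg] := hg; rewrite k0 /= in sg *; rewrite /Z_poly flats_rank0 // big_set1.
  rewrite -/(rank M) k0 KL_contraction_ground // big_ord1 sub0n !expr0 !mulr1.
  move=> /(congr1 (fun p : {poly int} => p`_0)); rewrite coefZ coef1 mulr1 => g0.
  case: i => [|i]; first by rewrite -g0.
  by rewrite nth_default // (leq_trans sg).
have [_ eZ] := KL_sparse T P M hP sM k0.
pose g' := \poly_(i < (rank M)./2.+1) sparse_gamma T M i.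
have hg' : is_gamma_poly (rank M) (Z_poly P M) g'.
  split; first exact: size_poly.
  by rewrite eZ sparse_ZE; apply: eq_bigr => j _; rewrite coef_poly ltn_ord.
rewrite (gamma_unique hg hg') coef_poly; case: ifP => // _.
exact: sparse_gamma_ge0.
Qed.
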